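(* For all $n\ge1$ and all $\sigma\in S_n(321)$, $(\mathrm{fp},\mathrm{exc},\mathrm{crs})(\Theta(\sigma))=(\mathrm{fp},\mathrm{exc},\mathrm{crs})(\sigma)$; i.e. $\Theta$ preserves the number of fixed points, of excedances and of crossings.
   Context: $S_n(\tau)$: permutations of $[n]$ avoiding the pattern $\tau$. For $\sigma\in S_n$: $\mathrm{fp}(\sigma)=|\{i:\sigma(i)=i\}|$, $\mathrm{exc}(\sigma)=|\{i:\sigma(i)>i\}|$; a crossing is a pair $(i,j)$ with $i<j<\sigma(i)<\sigma(j)$ or $\sigma(i)<\sigma(j)\le i<j$, and $\mathrm{crs}(\sigma)$ is their number. Definition of $\Theta$: for $\sigma\in S_n(321)$ let $(P,Q)$ be the insertion and recording tableaux of the RSK correspondence applied to $\sigma$ (at most two rows). $\Psi(\sigma)$ is the path of $2n$ steps $u=(1,1)$, $d=(1,-1)$ whose first $n$ steps are, for $i=1,\dots,n$, $u$ if $i$ is in the first row of $P$ and $d$ if in the second, and whose last $n$ steps are, for $j=n,\dots,1$, $u$ if $j$ is in the second row of $Q$ and $d$ if in the first; it is a Dyck path. Each up-step is matched with the first later down-step ending at the height where the up-step starts. Labelling up-steps left to right $n,\dots,1$ and down-steps left to right $1,\dots,n$, $\Phi^{-1}(D)$ sends each up-step label to the label of its matched down-step; it is a bijection onto $S_n(132)$. $\Theta=\Phi^{-1}\circ\Psi$. *)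

(* Defs.v *)
From HB Require Import structures.
From mathcomp Require Import all_boot all_order ssralg ssrnum ssrint.
From mathcomp Require Import fingroup perm zify.

Set Implicit Arguments.
Unset Strict Implicit.
Unset Printing Implicit Defensive.

Import Order.TTheory.

(* Permutations of {1, ..., n} are elements of 'S_n, i.e., permutations of    *)
(* {0, ..., n - 1}: positions, values, tableau entries and step labels are    *)
(* all shifted down by 1.                                                     *)

Section Statistics.

Variables (n : nat) (s : 'S_n).

Definition fp := #|[set i : 'I_n | s i == i]|.

Definition exc := #|[set i : 'I_n | i < s i]|.

Definition crossing (i j : 'I_n) : bool :=
  [&& i < j, j < s i & s i < s j] || [&& s i < s j, s j <= i & i < j].

Definition crs := #|[set ij : 'I_n * 'I_n | crossing ij.1 ij.2]|.

(* The pattern t is given in one-line notation; only the relative order of    *)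
(* its entries matters.                                                       *)
Definition contains (t : seq nat) : bool :=
  [exists f : {ffun 'I_(size t) -> 'I_n},
     [forall i : 'I_(size t), forall j : 'I_(size t),
        ((i < j) ==> (f i < f j)) &&
        ((s (f i) < s (f j)) == (nth 0 t i < nth 0 t j))]].

End Statistics.

Definition Av (n : nat) (t : seq nat) : {set 'S_n} :=
  [set s : 'S_n | ~~ contains s t].

(* Row insertion of x into the tableau T (a list of rows); the second         *)
(* component is the index of the row that has grown.                          *)
Fixpoint row_insert (x : nat) (T : seq (seq nat)) : seq (seq nat) * nat :=
  if T is r :: T' then
    let k := find (fun y => x < y) r in
    if k < size r then
      let: (T'', i) := row_insert (nth 0 r k) T' in (set_nth 0 r k x :: T'', i.+1)
    else (rcons r x :: T', 0)
  else ([:: [:: x]], 0).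

Definition rsk_step (PQ : seq (seq nat) * seq (seq nat)) (jx : nat * nat) :=
  let: (P, i) := row_insert jx.2 PQ.1 in
  (P, set_nth [::] PQ.2 i (rcons (nth [::] PQ.2 i) jx.1)).

Definition RSK (w : seq nat) : seq (seq nat) * seq (seq nat) :=
  foldl rsk_step ([::], [::]) (zip (iota 0 (size w)) w).

Definition word (n : nat) (s : 'S_n) : seq nat :=
  [seq (s i : nat) | i <- enum 'I_n].

(* Paths are sequences of booleans: true is u = (1, 1), false is d = (1, -1). *)
Definition Psi (n : nat) (s : 'S_n) : seq bool :=
  let: (P, Q) := RSK (word s) in
  [seq i \in nth [::] P 0 | i <- iota 0 n] ++
  [seq j \in nth [::] Q 1 | j <- rev (iota 0 n)].

(* The height of the path after its first k steps. *)
Definition height (D : seq bool) (k : nat) : int :=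
  ((count id (take k D))%:Z - (count negb (take k D))%:Z)%R.

Definition up_steps (D : seq bool) : seq nat :=
  [seq p <- iota 0 (size D) | nth false D p].

Definition down_steps (D : seq bool) : seq nat :=
  [seq p <- iota 0 (size D) | ~~ nth false D p].

(* The position of the down-step matched with the up-step at position p, or   *)
(* size D if there is none.                                                   *)
Definition match_step (D : seq bool) (p : nat) : nat :=
  find (fun q => [&& p < q, ~~ nth false D q & height D q.+1 == height D p])
       (iota 0 (size D)).

(* From the label of an up-step (right to left) to the label of the matched   *)
(* down-step (left to right).                                                 *)
Definition Phi_inv_label (D : seq bool) (i : nat) : nat :=
  index (match_step D (nth 0 (rev (up_steps D)) i)) (down_steps D).

(* The default values of insubd are only used when D is not a Dyck path of    *)
(* length 2n, see Phi_invE below.                                             *)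
Definition Phi_inv (n : nat) (D : seq bool) : 'S_n :=
  insubd (1%g : 'S_n) [ffun i : 'I_n => insubd i (Phi_inv_label D i)].

Definition Theta (n : nat) (s : 'S_n) : 'S_n := Phi_inv n (Psi s).

Definition Dyck (n : nat) (D : seq bool) : Prop :=
  [/\ size D = n.*2, height D n.*2 = 0%R & forall k, (0 <= height D k)%R].

(* Sanity: Theta is the intended map on Av n [:: 3; 2; 1].                    *)

Section PhiInv.

Variables (n : nat) (D : seq bool).
Hypothesis DyckD : Dyck n D.

Lemma heightS k : k < size D ->
  height D k.+1 = (height D k + (if nth false D k then 1 else -1))%R.
Proof.
move=> ltk; rewrite /height (take_nth false ltk) -cats1 !count_cat /=.
by case: (nth _ _ _) => /=; lia.
Qed.

Lemma count_up : count id D = n /\ count negb D = n.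
Proof.
case: DyckD => sD h0 _; move: h0; rewrite /height -sD take_size.
have := count_predC id D; rewrite sD.
have -> : count (predC id) D = count negb D by apply: eq_count.
by lia.
Qed.

Lemma size_stepsE :
  size (up_steps D) = n /\ size (down_steps D) = n.
Proof.
have [cu cd] := count_up.
have E (a : pred bool) : count a D = count (fun p => a (nth false D p)) (iota 0 (size D)).
  by rewrite -{1}(mkseq_nth false D) /mkseq count_map.
by rewrite !size_filter; split; [rewrite -[RHS]cu E | rewrite -[RHS]cd E].
Qed.

Lemma match_stepP p : p < size D -> nth false D p ->
  let q := match_step D p in
  [/\ p < q, q < size D, ~~ nth false D q, height D q.+1 = height D p
    & forall r, p < r <= q -> (height D p < height D r)%R].
Proof.
move=> ltp up q; case: DyckD => sD h0 hge.
have ex : exists k, (p < k <= size D) && (height D k <= height D p)%R.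
  by exists (size D); rewrite ltp leqnn /= sD h0 hge.
case: (ex_minnP ex) => k /andP[/andP[ltpk lekD] hk] kmin.
have hp1 := heightS ltp; rewrite up in hp1.
have ltpk1 : p.+1 < k.
  by move: hk; case: (ltngtP p.+1 k) ltpk => // <- _; lia.
case: k => [//|k] in ltpk lekD hk kmin ltpk1 *.
have hk' : (height D p < height D k)%R.
  have := kmin k; case: (leP (height D k) (height D p)) => // _.
  by rewrite andbT => /(_ _); lia.
have hS := heightS lekD.
have [dk hkE] : ~~ nth false D k /\ height D k.+1 = height D p.
  by move: hS; case: (nth _ _ _) => hS; split => //; lia.
pose P q := [&& p < q, ~~ nth false D q & height D q.+1 == height D p].
have Pk : P k by rewrite /P dk hkE eqxx andbT /=; lia.
have hasP : has P (iota 0 (size D)).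
  by apply/hasP; exists k => //; rewrite mem_iota.
have ltq : q < size D by have := hasP; rewrite has_find size_iota.
have := nth_find 0 hasP; rewrite -/(match_step D p) -/q nth_iota // add0n.
move=> /and3P[pq dq /eqP hq]; split=> //.
have qk : q <= k.
  rewrite leqNgt; apply/negP => kq.
  have := before_find 0 kq; rewrite nth_iota ?add0n; last by lia.
  by rewrite -/(P k) Pk.
move=> r /andP[pr rq]; case: (ltP (height D p) (height D r)) => // hr.
by have := kmin r; rewrite hr andbT => /(_ _); lia.
Qed.

Lemma nth_up i : i < n ->
  let p := nth 0 (rev (up_steps D)) i in p < size D /\ nth false D p.
Proof.
move=> lti p; have [su _] := size_stepsE.
have : p \in rev (up_steps D) by rewrite mem_nth // size_rev su.
by rewrite mem_rev mem_filter mem_iota => /andP[-> /andP[_]].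
Qed.

Lemma Phi_inv_label_lt i : i < n -> Phi_inv_label D i < n.
Proof.
move=> lti; have [ltp up] := nth_up lti; have [_ sd] := size_stepsE.
have [_ ltq dq _ _] := match_stepP ltp up.
rewrite /Phi_inv_label -[X in _ < X]sd index_mem mem_filter mem_iota.
by rewrite dq.
Qed.

Lemma match_step_inj p q : p < size D -> nth false D p ->
  q < size D -> nth false D q -> match_step D p = match_step D q -> p = q.
Proof.
wlog lepq : p q / p <= q => [hw | ltp up ltq uq E].
  by case: (leqP p q) => [/hw //|/ltnW /hw h *]; apply/esym/h.
have [_ _ _ hp hmin] := match_stepP ltp up.
have [qm _ _ hq _] := match_stepP ltq uq.
case: (ltngtP p q) lepq => // pq _.
by have := hmin q; rewrite -hp E hq => /(_ _); lia.
Qed.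

Lemma Phi_inv_label_inj i j : i < n -> j < n ->
  Phi_inv_label D i = Phi_inv_label D j -> i = j.
Proof.
move=> lti ltj; have [ltp up] := nth_up lti; have [ltq uq] := nth_up ltj.
have [su sd] := size_stepsE.
have inD p : p < size D -> nth false D p -> match_step D p \in down_steps D.
  move=> lp u; have [_ l d _ _] := match_stepP lp u.
  by rewrite mem_filter mem_iota d.
move=> /(index_inj 0 (inD _ ltp up) (inD _ ltq uq)) /(match_step_inj ltp up ltq uq) /eqP.
rewrite nth_uniq ?size_rev ?su // => [/eqP //|].
by rewrite rev_uniq filter_uniq // iota_uniq.
Qed.

Lemma Phi_invE (i : 'I_n) : Phi_inv n D i = Phi_inv_label D i :> nat.
Proof.
have E (k : 'I_n) : insubd k (Phi_inv_label D k) = Phi_inv_label D k :> nat.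
  by rewrite val_insubd Phi_inv_label_lt.
have inj : injectiveb [ffun k : 'I_n => insubd k (Phi_inv_label D k)].
  apply/injectiveP => k l; rewrite !ffunE => /(congr1 val) /=.
  by rewrite !E => /Phi_inv_label_inj h; apply/val_inj/h.
by rewrite -pvalE /Phi_inv insubdK // ffunE E.
Qed.

End PhiInv.

Section PsiDyck.

Local Notation row T k := (nth [::] T k).
Local Notation below v := (fun y : nat => y < v).

Lemma row_insert_append m x T : size T <= m.+1 ->
  {in row T 0, forall y, y <= x} ->
  exists T', [/\ row_insert x T = (T', 0), size T' <= m.+1,
    row T' 0 = rcons (row T 0) x & forall k, row T' k.+1 = row T k.+1].
Proof.
case: T => [|r T] sT hx.
  by exists [:: [:: x]]; split=> // k; rewrite /= nth_nil.
exists (rcons r x :: T); split => //=; case: ifP => //.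
by rewrite -has_find => /hasP[y /hx] /=; lia.
Qed.

Lemma row_insert_bump x T : size T <= 2 ->
  let r := row T 0 in let k := find (fun y => x < y) r in let y := nth 0 r k in
  k < size r -> {in row T 1, forall z, z <= y} ->
  exists T', [/\ row_insert x T = (T', 1), size T' <= 2,
    row T' 0 = set_nth 0 r k x & row T' 1 = rcons (row T 1) y].
Proof.
case: T => [|r T] //= sT ltk hy; rewrite ltk.
have [//|//|T' [-> sT' r0 _]] :=
  @row_insert_append 0 (nth 0 r (find (fun y => x < y) r)) T.
by exists (set_nth 0 r (find (fun y => x < y) r) x :: T').
Qed.

Lemma RSK_rcons w x : RSK (rcons w x) = rsk_step (RSK w) (size w, x).
Proof.
rewrite /RSK size_rcons -addn1 iotaD cats1 add0n zip_rcons ?size_iota //.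
by rewrite foldl_rcons.
Qed.

Definition lower (w : seq nat) (y : nat) :=
  exists i j, [/\ i < j < size w, nth 0 w j < nth 0 w i & y <= nth 0 w j].

Definition free321 (w : seq nat) := forall i j k,
  i < j -> j < k -> k < size w -> nth 0 w k < nth 0 w j -> nth 0 w j < nth 0 w i ->
  False.

Record rsk_inv (w : seq nat) (P Q : seq (seq nat)) : Prop := RskInv {
  inv_size : size P <= 2;
  inv_sorted : sorted ltn (row P 0);
  inv_perm : perm_eq (row P 0 ++ row P 1) w;
  inv_lower : forall y z, y \in row P 0 -> z \in row P 1 -> y < z -> lower w y;
  inv_ballotP : forall v, count (below v) (row P 1) <= count (below v) (row P 0);
  inv_permQ : perm_eq (row Q 0 ++ row Q 1) (iota 0 (size w));
  inv_shape0 : size (row Q 0) = size (row P 0);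
  inv_shape1 : size (row Q 1) = size (row P 1);
  inv_ballotQ : forall v, count (below v) (row Q 1) <= count (below v) (row Q 0)
}.

Lemma lower_rcons w x y : lower w y -> lower (rcons w x) y.
Proof.
move=> [i [j [/andP[ij jw] h1 h2]]]; exists i, j; rewrite size_rcons !nth_rcons.
by rewrite jw (ltn_trans ij jw) ij /= ltnS (ltnW jw).
Qed.

Lemma lower_last w x z : z \in w -> x < z -> lower (rcons w x) x.
Proof.
move=> zw xz; exists (index z w), (size w).
by rewrite size_rcons !nth_rcons index_mem zw ltnn eqxx nth_index //= ltnSn.
Qed.

Lemma rsk_invP w : uniq w -> free321 w -> rsk_inv w (RSK w).1 (RSK w).2.
Proof.
elim/last_ind: w => [|w x IH] uw fw; first by split.
rewrite rcons_uniq in uw; case/andP: uw => xw uw.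
have fw' : free321 w.
  move=> i j k ij jk kw h1 h2; apply: (fw i j k ij jk).
  - by rewrite size_rcons; lia.
  - by rewrite !nth_rcons kw (ltn_trans jk kw).
  - by rewrite !nth_rcons (ltn_trans jk kw) (ltn_trans ij (ltn_trans jk kw)).
rewrite RSK_rcons; case: {IH}(RSK w) (IH uw fw') => P Q /= [].
rewrite /rsk_step /=; set r0 := row P 0; set r1 := row P 1.
set q0 := row Q 0; set q1 := row Q 1.
move=> sP so pm lo bP pQ s0 s1 bQ.
have mw y : (y \in w) = (y \in r0) || (y \in r1).
  by rewrite -(perm_mem pm) mem_cat.
have xr0 : x \notin r0 by apply: contra xw; rewrite mw => ->.
have qlt v (r : seq nat) : {subset r <= q0 ++ q1} -> size w < v ->
    count (below v) r = size r.
  move=> sr hv; apply/eqP; rewrite -all_count; apply/allP => y /sr.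
  by rewrite (perm_mem pQ) mem_iota => yw; apply: ltn_trans hv.
have c1 v : size w < v -> count (below v) q1 = size q1.
  by apply: qlt => y yq; rewrite mem_cat yq orbT.
have c0 v : size w < v -> count (below v) q0 = size q0.
  by apply: qlt => y yq; rewrite mem_cat yq.
pose k := find (fun y => x < y) r0.
case: (ltnP k (size r0)) => hk; last first.
  have hx : {in r0, forall y, y < x}.
    move=> y yr; rewrite ltn_neqAle [y <= x]leqNgt; apply/andP; split.
      by apply: contraNneq xr0 => <-.
    apply/negP => xy; move: hk; rewrite leqNgt -has_find => /hasPn /(_ _ yr).
    by rewrite xy.
  have [y /hx /ltnW //|T' [-> sT' E0 E1]] := @row_insert_append 1 x P sP.
  split=> //; rewrite ?E0 ?E1 ?nth_set_nth /= -/r0 -/r1 -/q0 -/q1.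
  - by case: r0 so hx {xr0 hk E0 s0 bP k mw lo pm} => [//|a r] /= so hx;
      rewrite rcons_path so; apply: hx; apply: mem_last.
  - by rewrite cat_rcons perm_sym perm_rcons perm_sym -cat1s perm_catCA /= perm_cons.
  - move=> y z; rewrite mem_rcons inE => /orP[/eqP->|yr] zr yz.
      by apply: lower_last yz; rewrite mw zr orbT.
    by apply/lower_rcons/(lo y z).
  - by move=> v; rewrite -cats1 count_cat; have := bP v; lia.
  - rewrite size_rcons -addn1 iotaD add0n cat_rcons -cat1s perm_catCA.
    by rewrite perm_sym perm_catC /= perm_cons perm_sym.
  - by rewrite !size_rcons s0.
  - by [].
  - by move=> v; rewrite -cats1 count_cat; have := bQ v; lia.
set y := nth 0 r0 k.
have xy : x < y by apply: (nth_find 0); rewrite has_find.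
have yr0 : y \in r0 by rewrite mem_nth.
have yw : y \in w by rewrite mw yr0.
have hy : {in r1, forall z, z < y}.
  move=> z zr; rewrite ltnNge; apply/negP => yz.
  have ur : uniq (r0 ++ r1) by rewrite (perm_uniq pm).
  have yz' : y < z.
    rewrite ltn_neqAle yz andbT; apply/eqP => E.
    by move: ur; rewrite cat_uniq => /and3P[_ /hasPn /(_ _ zr)]; rewrite -E yr0.
  have [i [j [/andP[ij jw] h1 h2]]] := lo y z yr0 zr yz'.
  have iw := ltn_trans ij jw.
  by apply: (fw i j (size w)) => //; rewrite ?size_rcons ?nth_rcons ?iw ?jw
    ?ltnn ?eqxx //; lia.
have [|T' [-> sT' E0 E1]] := @row_insert_bump x P sP hk.
  by move=> z /hy /ltnW.
rewrite -/r0 -/r1 -/k -/y in E0 E1.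
have Er : r0 = take k r0 ++ y :: drop k.+1 r0.
  by rewrite -drop_nth // cat_take_drop.
have Es : set_nth 0 r0 k x = take k r0 ++ x :: drop k.+1 r0.
  by rewrite set_nthE hk.
have tx : {in take k r0, forall z, z < x}.
  move=> z zt; have /(nthP 0) [i] := zt; rewrite size_take hk => ik.
  rewrite nth_take // => Ez.
  have := before_find 0 ik; rewrite Ez => /negbT.
  rewrite -leqNgt leq_eqVlt => /orP[/eqP E|//].
  by move: xr0; rewrite -E (mem_take zt).
have dy : {in drop k.+1 r0, forall z, y < z}.
  move=> z zd; move: so; rewrite (sorted_pairwise ltn_trans) Er pairwise_cat.
  by move=> /and3P[_ _] /= /andP[/allP /(_ _ zd)].
have Ec a : count a r0 = count a (take k r0) + (a y + count a (drop k.+1 r0)).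
  by rewrite {1}Er count_cat.
have cr v : count (below v) (set_nth 0 r0 k x) + (y < v) =
            count (below v) r0 + (x < v).
  by rewrite Es Ec !count_cat /=; lia.
split=> //; rewrite ?E0 ?E1 ?nth_set_nth /= -/r0 -/r1 -/q0 -/q1.
- move: so; rewrite Es {1}Er !(sorted_pairwise ltn_trans) !pairwise_cat.
  rewrite !allrel_consr /= => /and3P[/andP[_ a1] a2 /andP[_ a3]].
  rewrite a1 a2 a3 !andbT /=; apply/andP; split.
    by apply/allP => z /tx.
  by apply/allP => z /dy; apply: ltn_trans.
- apply/seq.permP => a; rewrite Es -!cats1 !count_cat /=.
  by rewrite -(seq.permP pm a) count_cat Ec /=; lia.
- move=> u z uu; rewrite mem_rcons inE.
  have {uu} : u \in x :: r0.
    move: uu; rewrite Es inE mem_cat inE => /or3P[/mem_take->|->//|/mem_drop->];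
    by rewrite orbT.
  rewrite inE => /orP[/eqP -> _ _|ur]; first exact: lower_last xy.
  case/orP=> [/eqP -> uy|zr uz]; last by apply/lower_rcons/(lo u z).
  have [i [j [a b c]]] := lower_last yw xy; exists i, j; split=> //.
  suff ux : u < x by apply: leq_trans c; apply: ltnW.
  move: ur; rewrite Er mem_cat inE => /or3P[/tx //|/eqP Eu|/dy]; lia.
- move=> v; rewrite -cats1 count_cat /=; have := bP v; have := cr v.
  case: (ltnP y v) => yv /=; last by lia.
  have -> : count (below v) r1 = count (below y) r1.
    by apply: eq_in_count => z /hy /=; lia.
  have : count (below y) r0 < count (below v) r0.
    have sub r : count (below y) r <= count (below v) r.
      by apply: sub_count => z /= /ltn_trans; apply.
    rewrite !Ec ltnn yv.
    by have := sub (take k r0); have := sub (drop k.+1 r0); lia.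
  by have := bP y; lia.
- rewrite size_rcons -addn1 iotaD add0n -rcons_cat -cats1.
  by rewrite perm_cat2r.
- by rewrite s0 Es {1}Er !size_cat.
- by rewrite !size_rcons s1.
- move=> v; rewrite -cats1 count_cat /=; have := bQ v.
  case: (ltnP (size w) v) => hv /=; last by lia.
  rewrite c1 // c0 // s0 s1 => _.
  have : count (below y) r0 < size r0.
    rewrite Er count_cat /= ltnn size_cat /=.
    by have := count_size (below y) (take k r0);
       have := count_size (below y) (drop k.+1 r0); lia.
  have := bP y; suff -> : count (below y) r1 = size r1 by lia.
  by apply/eqP; rewrite -all_count; apply/allP.
Qed.

Lemma size_word n (s : 'S_n) : size (word s) = n.
Proof. by rewrite size_map size_enum_ord. Qed.

Lemma nth_word n (s : 'S_n) (i : 'I_n) : nth 0 (word s) i = s i.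
Proof. by rewrite (nth_map i) ?size_enum_ord // nth_ord_enum. Qed.

Lemma perm_word n (s : 'S_n) : perm_eq (word s) (iota 0 n).
Proof.
apply: uniq_perm; rewrite ?iota_uniq //.
  by rewrite map_inj_uniq ?enum_uniq // => i j /val_inj /perm_inj.
move=> y; rewrite mem_iota /= add0n; apply/mapP/idP => [[i _ ->] // | lty].
by exists ((s^-1)%g (Ordinal lty)); rewrite ?mem_enum // permKV.
Qed.

Lemma free321_word n (s : 'S_n) : s \in Av n [:: 3; 2; 1] -> free321 (word s).
Proof.
rewrite inE => /negP av i j k ij jk; rewrite size_word => kn.
have jn := ltn_trans jk kn; have in_ := ltn_trans ij jn.
rewrite (nth_word s (Ordinal kn)) (nth_word s (Ordinal jn)).
rewrite (nth_word s (Ordinal in_)) => h1 h2; apply: av; apply/existsP.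
exists [ffun t : 'I_3 => nth (Ordinal kn) [:: Ordinal in_; Ordinal jn] t].
apply/forallP => -[[|[|[|//]]] ha]; apply/forallP => -[[|[|[|//]]] hb].
all: by rewrite !ffunE /=; lia.
Qed.

Lemma count_mem_iota (r : seq nat) k : uniq r ->
  count [in r] (iota 0 k) = count (below k) r.
Proof.
move=> ur; rewrite -!size_filter; apply/perm_size/uniq_perm.
- by rewrite filter_uniq ?iota_uniq.
- by rewrite filter_uniq.
- by move=> y; rewrite !mem_filter mem_iota add0n /= andbC.
Qed.

Lemma Psi_Dyck n (s : 'S_n) : s \in Av n [:: 3; 2; 1] -> Dyck n (Psi s).
Proof.
move=> /free321_word fs.
have uw : uniq (word s) by rewrite (perm_uniq (perm_word s)) iota_uniq.
case: (rsk_invP uw fs); rewrite /Psi size_word.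
case: (RSK _) => P Q /=; set r0 := row P 0; set r1 := row P 1.
set q0 := row Q 0; set q1 := row Q 1 => _ _ pP _ bP pQ s0 s1 bQ.
have {}pP := perm_trans pP (perm_word s).
have part a b : perm_eq (a ++ b) (iota 0 n) ->
  [/\ uniq a, uniq b, forall y, y < n -> (y \notin a) = (y \in b),
      count (below n) a = size a & count (below n) b = size b].
  move=> pm; have : uniq (a ++ b) by rewrite (perm_uniq pm) iota_uniq.
  rewrite cat_uniq => /and3P[ua /hasPn hab ub]; split=> //.
  - move=> y yn; have : y \in a ++ b by rewrite (perm_mem pm) mem_iota.
    by rewrite mem_cat; case: (boolP (y \in b)) => [/hab //|]; rewrite orbF => _ ->.
  - apply/eqP; rewrite -all_count; apply/allP => y ya.
    by have := perm_mem pm y; rewrite mem_cat ya mem_iota => /esym /andP[].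
  - apply/eqP; rewrite -all_count; apply/allP => y yb.
    by have := perm_mem pm y; rewrite mem_cat yb orbT mem_iota => /esym /andP[].
have [u0 u1 r01 c0 c1] := part _ _ pP.
have [v0 v1 q01 d0 d1] := part _ _ pQ.
have sr : size r0 + size r1 = n by rewrite -size_cat (perm_size pP) size_iota.
set D := _ ++ _.
have sD : size D = n.*2 by rewrite size_cat !size_map size_rev size_iota addnn.
have h1 k : k <= n ->
    height D k = ((count (below k) r0)%:Z - (count (below k) r1)%:Z)%R.
  move=> kn; rewrite /height /D takel_cat ?size_map ?size_iota //.
  rewrite -map_take take_iota (minn_idPl kn) !count_map -!count_mem_iota //.
  congr (_%:Z - _%:Z)%R; apply: eq_in_count => y; rewrite mem_iota /= => yk.
  by apply: r01; lia.
have h2 m : m <= n -> height D (n.*2 - m) =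
    ((count (below m) q0)%:Z - (count (below m) q1)%:Z)%R.
  move=> mn.
  have cut a : count a (iota m (n - m)) = count a (iota 0 n) - count a (iota 0 m).
    by rewrite -{2}(subnKC mn) iotaD add0n count_cat; lia.
  have mono r : count (below m) r <= count (below n) r.
    by apply: sub_count => y /= ym; apply: leq_trans mn.
  have tD : take (n.*2 - m) D = [seq i \in r0 | i <- iota 0 n] ++
      [seq j \in q1 | j <- rev (iota m (n - m))].
    rewrite /D take_cat size_map size_iota ltnNge.
    rewrite (_ : n <= n.*2 - m) /=; last by lia.
    rewrite -map_take (_ : n.*2 - m - n = n - m); last by lia.
    by rewrite take_rev size_iota drop_iota subKn.
  rewrite /height tD !count_cat !count_map !count_rev.
  have -> : count (preim (mem r0) negb) (iota 0 n) = size r1.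
    rewrite -[RHS]c1 -count_mem_iota //; apply: eq_in_count => y.
    by rewrite mem_iota => /r01.
  have -> : count (preim (mem q1) negb) (iota m (n - m)) =
            count [in q0] (iota m (n - m)).
    apply: eq_in_count => y; rewrite mem_iota /= => yn; rewrite -q01 ?negbK //.
    by lia.
  have -> : count (preim (mem r0) id) (iota 0 n) = size r0.
    by rewrite -[RHS]c0 -count_mem_iota.
  have -> : count (preim (mem q1) id) (iota m (n - m)) =
            count [in q1] (iota m (n - m)) by [].
  rewrite !cut !count_mem_iota // d0 d1.
  by have := mono q0; have := mono q1; rewrite d0 d1 s0 s1; lia.
have hend : height D n.*2 = 0%R.
  by have := h2 0 (leq0n n); rewrite subn0 => ->; rewrite -!count_mem_iota.
split=> // k; case: (leqP k n) => [kn|nk]; first by rewrite h1 //; have := bP k; lia.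
case: (leqP k n.*2) => [k2|k2].
  by rewrite -(subKn k2) h2; [have := bQ (n.*2 - k); lia | lia].
suff -> : height D k = height D n.*2 by rewrite hend.
by rewrite /height !take_oversize ?sD // ltnW.
Qed.

End PsiDyck.

Lemma ThetaE n (s : 'S_n) (i : 'I_n) : s \in Av n [:: 3; 2; 1] ->
  Theta s i = Phi_inv_label (Psi s) i :> nat.
Proof. by move=> /Psi_Dyck DP; apply: Phi_invE. Qed.

(* Main.v *)
Require Import Defs.
From mathcomp Require Import all_boot all_order ssralg ssrnum ssrint fingroup perm zify.

(* Call i an excedance if s i > i. For every permutation s, counting for each
   k the arcs i -> s i that pass over k gives
     crs + exc + invEE + invNN = sum of (s i - i) over the excedances = invEN,
   where invXY counts the inversions (i, j) with i of type X and j of type Y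
   (E: excedance, N: non-excedance).

   If s avoids 321, every inversion is of type EN, and RSK matches some
   excedances (bumped entries) with some non-excedances (bumping entries):
   the second row of P lists the values of the former, the second row of Q
   the positions of the latter.

   For pi = Theta s, the entries of pi are the arcs (tunnels) of the path
   Psi s, the sign of pi i - i tells on which side of the middle the centre of
   the arc lies, and the inversions are the pairs of disjoint arcs. An
   unmatched excedance of s of value v starts an arc at step v of the left
   half, and the heights force its centre to the right of the middle; an
   unmatched non-excedance at position z ends an arc at the mirror image of
   step z, with centre in the middle if z is a fixed point and to its left
   otherwise. A count shows that these are all the arcs joining the two halves,
   which settles fp and exc. For crs, both sides are then expressed by the
   second rows of P and Q and by the unmatched entries. *)

Set Implicit Arguments.
Unset Strict Implicit.
Unset Printing Implicit Defensive.

Import Order.TTheory.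

Local Notation row T k := (nth [::] T k).

(** * Sums of indicators over finite types *)

Lemma card_set_sum (T : finType) (P : pred T) : #|[set x | P x]| = \sum_x P x.
Proof.
by rewrite -sum1_card big_mkcond; apply: eq_bigr => x _; rewrite inE; case: (P x).
Qed.

Lemma sum_ord_itv n a b : b <= n -> \sum_(k < n) (a <= k < b) = b - a.
Proof.
(* The form with [minn n b] holds without the bound on [b], so induction on [n] applies to it. *)
move=> bn; suff -> : \sum_(k < n) (a <= k < b) = minn n b - a by rewrite (minn_idPr bn).
elim: n {bn} => [|n IH]; first by rewrite big_ord0 min0n.
by rewrite big_ord_recr /= IH; lia.
Qed.

Lemma sum_ord_lt n b : b <= n -> \sum_(k < n) (k < b) = b.
Proof. by move=> bn; rewrite -[RHS]subn0 -(sum_ord_itv 0 bn). Qed.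

(** The second half is indexed from the right end, as in the definition of [Psi]. *)
Lemma sum_double n (F : nat -> nat) :
  \sum_(u < n.*2) F u = \sum_(i < n) F i + \sum_(j < n) F (n.*2.-1 - j).
Proof.
rewrite -(big_mkord xpredT F) (@big_cat_nat _ _ _ n) //=; last by lia.
rewrite big_mkord; congr (_ + _).
rewrite -(big_mkord xpredT (fun j => F (n.*2.-1 - j))) -{1}[n]add0n big_addn.
rewrite (_ : n.*2 - n = n); last by lia.
rewrite big_nat_rev /=.
by apply: eq_big_nat => j jn; congr F; lia.
Qed.

(** Spreads a unit over the index set, so that strict inequalities between sums can be proved term
    by term. *)
Lemma sum_eq1 (T : finType) (x : T) : \sum_y (y == x) = 1.
Proof. by rewrite (bigD1 x) //= eqxx big1 // => y /negbTE ->. Qed.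

Lemma sum_inj_codom m n (e : 'I_m -> 'I_n) (f : 'I_n -> nat) : injective e ->
  \sum_(k < m) f (e k) = \sum_(i < n) (i \in codom e) * f i.
Proof.
move=> inj_e; transitivity (\sum_(i in codom e) f i); last first.
  by rewrite big_mkcond; apply: eq_bigr => i _; case: (_ \in _); rewrite ?mul1n.
have ue : uniq (codom e) by apply/injectiveP.
by rewrite -(big_uniq _ ue) codomE big_map big_enum.
Qed.

(** The relation, its transpose and the diagonal partition the square of [T]. *)
Lemma sum_asym_rel (T : finType) (r : rel T) :
  (forall x, ~~ r x x) -> (forall x y, x != y -> r x y + r y x = 1) ->
  (\sum_x \sum_y r x y).*2 + #|T| = #|T| * #|T|.
Proof.
move=> rx rxy; rewrite -addnn {1}exchange_big -!big_split /=.
rewrite -{1}sum1_card -big_split /=.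
rewrite (eq_bigr (fun=> #|T|)) ?sum_nat_const // => x _.
rewrite -big_split /= -(sum_eq1 x) -big_split /= -sum1_card.
apply: eq_bigr => y _; case: (eqVneq y x) => [->|/rxy ->//].
by rewrite (negbTE (rx x)).
Qed.

(** Adding the [m(m-1)/2] pairs with [x] in the image of [g] completes the first sum to one over all
    [x], in which each [k] contributes [n - 1 - g k]. *)
Lemma sum_below_codomC m n (g : 'I_m -> 'I_n) : injective g ->
  (\sum_(x < n) (x \notin codom g) * \sum_(k < m) (g k < x) + \sum_(k < m) g k).*2
    + m * m + m = (m * n).*2.
Proof.
move=> inj_g; set X := \sum_(x < n) _.
pose W := \sum_(l < m) \sum_(k < m) (g k < g l).
have hW : W.*2 + m = m * m.
  have := @sum_asym_rel 'I_m (fun l k => g k < g l); rewrite card_ord; apply.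
    by move=> x; rewrite ltnn.
  move=> x y xy; have : g x != g y :> nat by apply: contraNneq xy => /val_inj/inj_g ->.
  by lia.
have : X + W + \sum_(k < m) g k + m = m * n; last by lia.
have -> : W = \sum_(x < n) (x \in codom g) * \sum_(k < m) (g k < x).
  exact: (sum_inj_codom (fun x => \sum_(k < m) (g k < x)) inj_g).
have -> : X + \sum_(x < n) (x \in codom g) * \sum_(k < m) (g k < x) =
          \sum_(k < m) \sum_(x < n) (g k < x).
  rewrite exchange_big -big_split; apply: eq_bigr => x _ /=.
  by case: (_ \in _); rewrite mul1n mul0n ?addn0.
have m1 : \sum_(k < m) 1 = m by rewrite sum1_card card_ord.
rewrite -[X in _ + X = _]m1 -!big_split /=.
rewrite (eq_bigr (fun=> n)) ?sum_nat_const ?card_ord // => k _.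
have gn := ltn_ord (g k).
rewrite (eq_bigr (fun x : 'I_n => (g k < x < n) : nat)); last first.
  by move=> x _; rewrite ltn_ord andbT.
by rewrite sum_ord_itv //; lia.
Qed.

Lemma eq_of_leq_sum (T : finType) (f g : T -> nat) :
  (forall x, f x <= g x) -> \sum_x g x <= \sum_x f x -> f =1 g.
Proof.
move=> le_fg le_gf x; apply/eqP; rewrite eqn_leq le_fg /=.
move: le_gf; rewrite (bigD1 x) //= [X in _ <= X](bigD1 x) //=.
have : \sum_(y | y != x) f y <= \sum_(y | y != x) g y by apply: leq_sum => y _.
lia.
Qed.

(** * Crossings, excedances and inversions of an arbitrary permutation *)

Section PermIdentity.

Variables (n : nat) (s : 'S_n).

Lemma sum_perm (f : 'I_n -> nat) : \sum_(i < n) f (s i) = \sum_(i < n) f i.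
Proof. by rewrite [RHS](reindex_inj (@perm_inj _ s)). Qed.

Lemma perm_neq (i j : 'I_n) : i < j -> s i != s j :> nat.
Proof.
move=> ij; apply/eqP => /val_inj /perm_inj E; by rewrite E ltnn in ij.
Qed.

Definition invEE := \sum_(i < n) \sum_(j < n) [&& i < j, s j < s i & j < s j].
Definition invNN := \sum_(i < n) \sum_(j < n) [&& i < j, s j < s i & s i <= i].
Definition invEN := \sum_(i < n) \sum_(j < n) [&& i < j, s j < s i, i < s i & s j <= j].

(** There are as many indices as values up to [k]; cancelling the [i] with both [i] and [s i] at
    most [k] leaves the arcs that pass [k] in the two directions. *)
Lemma sum_over_under k :
  \sum_(j < n) (s j <= k < j) = \sum_(j < n) (j <= k < s j).
Proof.
have := sum_perm (fun j => (j <= k) : nat).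
have -> : \sum_(i < n) (s i <= k) =
    \sum_(i < n) ((i <= k) && (s i <= k)) + \sum_(i < n) (s i <= k < i).
  by rewrite -big_split; apply: eq_bigr => i _ /=; lia.
have -> : \sum_(i < n) (i <= k) =
    \sum_(i < n) ((i <= k) && (s i <= k)) + \sum_(i < n) (i <= k < s i).
  by rewrite -big_split; apply: eq_bigr => i _ /=; lia.
by move/addnI.
Qed.

(* Both sides count the pairs of an index k and an arc i -> s i passing over k;
   the subtraction is truncated, so that only excedances contribute. *)
Lemma crs_exc_sum : crs s + exc s + invEE + invNN = \sum_(i < n) (s i - i).
Proof.
have -> : crs s = \sum_(i < n) \sum_(j < n) crossing s i j.
  by rewrite /crs card_set_sum pair_big.
rewrite /exc card_set_sum.
(* Two overlapping arcs on the same side of the diagonal either cross or are nested, and the nested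
   ones are the EE and NN inversions. Each pair is recorded at the later index for excedances and at
   the earlier one for non-excedances. *)
have E : \sum_(i < n) \sum_(j < n) crossing s i j + invEE + invNN =
    \sum_(i < n) \sum_(j < n) [&& j < s j, i < j & j < s i] +
    \sum_(i < n) \sum_(j < n) [&& s i <= i, s j <= i & i < j].
  rewrite -!big_split; apply: eq_bigr => i _.
  rewrite -!big_split; apply: eq_bigr => j _.
  by rewrite /crossing /=; have := @perm_neq i j; lia.
have -> : \sum_(i < n) (s i - i) = \sum_(k < n) \sum_(i < n) (i <= k < s i).
  rewrite exchange_big; apply: eq_bigr => i _.
  by rewrite -(@sum_ord_itv n) // ltnW.
rewrite -!addnA [X in _ + X]addnC !addnA E [X in X + _ + _]exchange_big -!big_split.
apply: eq_bigr => k _ /=.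
have D1 : \sum_(i < n) (i <= k < s i) = (k < s k) + \sum_(i < n) (i < k < s i).
  rewrite (bigD1 k) //= leqnn (bigD1 k (F := fun i => (i < k < s i) : nat)) //=.
  rewrite ltnn /=; congr (_ + _); apply: eq_bigr => i ik.
  by rewrite leq_eqVlt (negbTE (ik : i != k :> nat)).
case: (ltnP k (s k)) => hk /=.
  by rewrite [X in _ + X + _]big1 // D1 hk addn0 addnC.
by rewrite big1 // add0n addn0 sum_over_under.
Qed.

(** For an excedance [i], comparing the [s i] smaller values with the [i] earlier positions shows
    that [s i - i] is the number of inversions starting at [i] minus the number ending at [i]. The
    latter are all EE and cancel the EE inversions among the former. *)
Lemma sum_exc_invEN : \sum_(i < n) (s i - i) = invEN.
Proof.
have EE' : \sum_(i < n) \sum_(j < n) [&& j < i, s i < s j & i < s i] = invEE.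
  by rewrite exchange_big.
apply/eqP; rewrite -(eqn_add2r invEE) -{1}EE'; apply/eqP.
rewrite /invEN /invEE -!big_split; apply: eq_bigr => i _ /=.
case: (ltnP i (s i)) => hi; last first.
  rewrite (_ : s i - i = 0); last by lia.
  by rewrite add0n -!big_split !big1 //= => j _; lia.
have E1 : \sum_(j < n) ((j < i) && (s i < s j)) + \sum_(j < n) ((j < i) && (s j < s i)) = i.
  rewrite -[RHS](@sum_ord_lt n i) 1?ltnW // -big_split; apply: eq_bigr => j _ /=.
  by have := @perm_neq j i; lia.
have E2 : \sum_(j < n) ((i < j) && (s j < s i)) + \sum_(j < n) ((j < i) && (s j < s i)) = s i.
  rewrite -[RHS](@sum_ord_lt n (s i)) 1?ltnW // -(sum_perm (fun k => (k < s i) : nat)).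
  rewrite -big_split; apply: eq_bigr => j _ /=.
  by case: (ltngtP i j) => [_|_|E] /=; rewrite ?addn0 // (val_inj E) ltnn.
have -> : \sum_(j < n) [&& j < i, s i < s j & true] = \sum_(j < n) ((j < i) && (s i < s j)).
  by apply: eq_bigr => j _; rewrite andbT.
have -> : \sum_(j < n) [&& i < j, s j < s i, true & s j <= j] +
          \sum_(j < n) [&& i < j, s j < s i & j < s j] = \sum_(j < n) ((i < j) && (s j < s i)).
  by rewrite -big_split; apply: eq_bigr => j _ /=; lia.
lia.
Qed.

End PermIdentity.

(** * Arcs of a Dyck path and the permutation they define *)

Lemma index_filter_iota (a : pred nat) N x : x < N -> a x ->
  index x [seq u <- iota 0 N | a u] = count a (iota 0 x).
Proof.
move=> xN ax; rewrite -(subnKC (ltnW xN)) iotaD filter_cat index_cat.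
rewrite mem_filter mem_iota /= add0n ltnn andbF size_filter.
have -> : N - x = (N - x).-1.+1 by lia.
by rewrite /= ax /= eqxx addn0.
Qed.

Section Arcs.

Variables (n : nat) (D : seq bool).
Hypothesis DyckD : Dyck n D.

Let pi := Phi_inv n D.

Definition ups k := count id (take k D).
Definition downs k := count negb (take k D).

Definition upos (i : 'I_n) := nth 0 (rev (up_steps D)) i.
Definition dpos (i : 'I_n) := match_step D (upos i).

Let sizeD : size D = n.*2. Proof. by case: DyckD. Qed.

Lemma count_take_nth (a : pred bool) k : k <= size D ->
  count a (take k D) = count (fun u => a (nth false D u)) (iota 0 k).
Proof. by move=> kD; rewrite -(map_nth_iota0 false kD) count_map. Qed.

Lemma ups_downs k : k <= n.*2 -> ups k + downs k = k.
Proof.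
move=> kn; rewrite /ups /downs -[RHS](size_takel (s := D)) ?sizeD //.
by rewrite -(count_predC id (take k D)); congr (_ + _); apply: eq_count.
Qed.

Lemma upsS k : k < n.*2 -> ups k.+1 = ups k + nth false D k.
Proof.
move=> kn; rewrite /ups (take_nth false) ?sizeD // -cats1 count_cat /=.
by rewrite addn0.
Qed.

Lemma leq_ups k l : k <= l -> ups k <= ups l.
Proof.
move=> kl; rewrite /ups -(subnKC kl) takeD count_cat; lia.
Qed.

Lemma leq_downs k l : k <= l -> downs k <= downs l.
Proof.
move=> kl; rewrite /downs -(subnKC kl) takeD count_cat; lia.
Qed.

Lemma upos_spec i : [/\ upos i < n.*2, nth false D (upos i) & ups (upos i) + i.+1 = n].
Proof.
have [lt up] := nth_up DyckD (ltn_ord i); split=> //; first by rewrite -sizeD.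
have [su _] := size_stepsE DyckD.
rewrite /ups count_take_nth; last exact: ltnW.
rewrite -(index_filter_iota lt) // /upos nth_rev ?su //.
rewrite -/(up_steps D) index_uniq ?su; first by have := ltn_ord i; lia.
  by have := ltn_ord i; lia.
by rewrite filter_uniq // iota_uniq.
Qed.

Lemma dpos_spec i : [/\ upos i < dpos i < n.*2, ~~ nth false D (dpos i),
  downs (dpos i) = pi i, height D (dpos i).+1 = height D (upos i)
  & forall r, upos i < r <= dpos i -> (height D (upos i) < height D r)%R].
Proof.
have [lt up _] := upos_spec i; rewrite -sizeD in lt.
have [pq qD dq hq hm] := match_stepP DyckD lt up; split=> //.
  by rewrite pq -sizeD.
rewrite /pi (Phi_invE DyckD) /Phi_inv_label -/(upos i) -/(dpos i).
rewrite index_filter_iota // /downs count_take_nth //; exact: ltnW.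
Qed.

Lemma dposE i : dpos i = nth 0 (down_steps D) (pi i).
Proof.
rewrite /pi (Phi_invE DyckD) nth_index //.
have [/andP[_ lt] dq _ _ _] := dpos_spec i.
by rewrite mem_filter dq mem_iota sizeD lt.
Qed.

(** The labels count up-steps and down-steps, and the heights at the two ends of the arc agree. The
    arc spans the abscissas [upos i] to [dpos i + 1], so [pi i - i] is the signed distance from the
    middle [n] to its centre. *)
Lemma upos_dpos i : upos i + dpos i + 1 + i.*2 = n.*2 + (pi i).*2.
Proof.
have [p1 p2 p3] := upos_spec i; have [/andP[q1 q2] q3 q4 q5 _] := dpos_spec i.
have h1 := ups_downs (ltnW p1); have h2 := ups_downs (ltnW q2).
have h3 := ups_downs q2; have h4 := upsS q2; rewrite (negbTE q3) addn0 in h4.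
move: q5; rewrite /height -!/(ups _) -!/(downs _); lia.
Qed.

Lemma ltn_upos i j : (upos i < upos j) = (j < i).
Proof.
have [p1 p2 p3] := upos_spec i; have [q1 q2 q3] := upos_spec j.
apply/idP/idP => h; last by rewrite ltnNge; apply/negP => /leq_ups; lia.
by have := leq_ups h; rewrite upsS // p2; lia.
Qed.

Lemma ltn_dpos i j : (dpos i < dpos j) = (pi i < pi j).
Proof.
have [/andP[_ p1] p2 p3 _ _] := dpos_spec i; have [/andP[_ q1] q2 q3 _ _] := dpos_spec j.
apply/idP/idP => h; last by rewrite ltnNge; apply/negP => /leq_downs; lia.
have := leq_downs h; have := ups_downs (ltnW p1); have := ups_downs p1.
by rewrite upsS // (negbTE p2); lia.
Qed.

(* Two arcs that overlap are nested, so an inversion is a pair of disjoint arcs. *)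
Lemma inversion_arcs (i j : 'I_n) : (i < j) && (pi j < pi i) = (dpos j < upos i).
Proof.
rewrite -ltn_upos -ltn_dpos.
have [/andP[pi1 _] _ _ _ mi] := dpos_spec i; have [/andP[pj1 _] _ _ hj mj] := dpos_spec j.
apply/andP/idP => [[pp qq]|h]; last by lia.
rewrite ltnNge; apply/negP => h.
by have := mj (upos i); have := mi (dpos j).+1; rewrite pp h hj => /(_ _); lia.
Qed.

Lemma exc_arcs (i : 'I_n) : (i < pi i) = (n.*2 <= upos i + dpos i).
Proof. by have := upos_dpos i; lia. Qed.

Lemma fp_arcs (i : 'I_n) : (pi i == i) = (upos i + dpos i + 1 == n.*2).
Proof.
rewrite -(inj_eq val_inj) /=; by have := upos_dpos i; lia.
Qed.

Lemma upos_inj : injective upos.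
Proof.
move=> i j E; apply/val_inj; have := ltn_upos i j; have := ltn_upos j i.
by rewrite E ltnn /=; lia.
Qed.

Lemma dpos_inj : injective dpos.
Proof.
move=> i j E; apply/(@perm_inj _ pi)/val_inj.
by have := ltn_dpos i j; have := ltn_dpos j i; rewrite E ltnn /=; lia.
Qed.

(** With [sum_dpos], this turns a sum over arcs into a sum over steps, indexed by either end. *)
Lemma sum_upos (f : nat -> nat) :
  \sum_(i < n) f (upos i) = \sum_(u < n.*2) nth false D u * f u.
Proof.
have [su _] := size_stepsE DyckD.
transitivity (\sum_(u <- rev (up_steps D)) f u).
  by rewrite (big_nth 0) size_rev su big_mkord.
rewrite (perm_big (up_steps D)) ?perm_rev //= /up_steps big_filter sizeD.
rewrite -[X in iota _ X]subn0 -/(index_iota 0 n.*2) big_mkord big_mkcond.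
by apply: eq_bigr => u _; case: (nth _ _ _); rewrite ?mul1n.
Qed.

Lemma sum_dpos (f : nat -> nat) :
  \sum_(i < n) f (dpos i) = \sum_(u < n.*2) ~~ nth false D u * f u.
Proof.
have [_ sd] := size_stepsE DyckD.
transitivity (\sum_(u <- down_steps D) f u).
  rewrite (big_nth 0) sd big_mkord -[RHS](sum_perm pi); apply: eq_bigr => i _.
  by rewrite dposE.
rewrite /down_steps big_filter sizeD.
rewrite -[X in iota _ X]subn0 -/(index_iota 0 n.*2) big_mkord big_mkcond.
by apply: eq_bigr => u _; case: (nth _ _ _); rewrite ?mul1n.
Qed.

Lemma upos_surj u : u < n.*2 -> nth false D u -> exists i, upos i = u.
Proof.
move=> un Du; have [su _] := size_stepsE DyckD.
have : u \in rev (up_steps D) by rewrite mem_rev mem_filter Du mem_iota sizeD.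
by case/(nthP 0) => i; rewrite size_rev su => ltn <-; exists (Ordinal ltn).
Qed.

Lemma dpos_surj u : u < n.*2 -> ~~ nth false D u -> exists i, dpos i = u.
Proof.
move=> un Du; have [_ sd] := size_stepsE DyckD.
have : u \in down_steps D by rewrite mem_filter Du mem_iota sizeD.
case/(nthP 0) => i; rewrite sd => ltn <-.
by exists ((pi^-1)%g (Ordinal ltn)); rewrite dposE permKV.
Qed.

Lemma ups_sum k : k <= n.*2 ->
  ups k = \sum_(u < n.*2) nth false D u * (u < k).
Proof.
move=> kn; rewrite /ups count_take_nth ?sizeD // -sum1_count.
rewrite -[X in iota _ X]subn0 -/(index_iota 0 k) (big_nat_widen _ _ _ _ _ kn).
rewrite big_mkord big_mkcond; apply: eq_bigr => u _ /=.
by case: (nth _ _ _); case: (_ < _).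
Qed.

End Arcs.

(** * Bumps of RSK on a 321-avoiding word *)

Lemma free321_rcons w x : free321 (rcons w x) -> free321 w.
Proof.
move=> fw i j k ij jk kw h1 h2; apply: (fw i j k ij jk).
- by rewrite size_rcons; lia.
- by rewrite !nth_rcons kw (ltn_trans jk kw).
- by rewrite !nth_rcons (ltn_trans jk kw) (ltn_trans ij (ltn_trans jk kw)).
Qed.

(** A bumped entry [y] exceeds the whole second row: an entry above it there would come, by
    [inv_lower], with a descending pair of letters at least [y], which [x < y] completes to a 321.
    Hence [y] is appended to the second row, and the second rows of P and Q grow together. *)
Lemma RSK_rcons321 w x : uniq (rcons w x) -> free321 (rcons w x) ->
  let: (P, Q) := RSK w in let: (P', Q') := RSK (rcons w x) in
  [/\ row P' 0 = rcons (row P 0) x, row P' 1 = row P 1, row Q' 1 = row Q 1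
    & {in row P 0, forall y, y < x}] \/
  exists2 y, [/\ y \in row P 0, x < y & {in row P 0, forall v, v < y -> v < x}] &
    [/\ {subset row P' 0 <= x :: row P 0}, row P' 1 = rcons (row P 1) y
      & row Q' 1 = rcons (row Q 1) (size w)].
Proof.
rewrite rcons_uniq => /andP[xw uw] fw.
have := rsk_invP uw (free321_rcons fw); rewrite RSK_rcons.
case: (RSK w) => P Q /= [sP so pm lo _ _ _ _ _]; rewrite /rsk_step /=.
have mw y : (y \in w) = (y \in row P 0) || (y \in row P 1).
  by rewrite -(perm_mem pm) mem_cat.
have xr0 : x \notin row P 0 by apply: contra xw; rewrite mw => ->.
pose k := find (fun y => x < y) (row P 0).
case: (ltnP k (size (row P 0))) => hk; last first.
  have hx : {in row P 0, forall y, y < x}.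
    move=> y yr; rewrite ltn_neqAle [y <= x]leqNgt; apply/andP; split.
      by apply: contraNneq xr0 => <-.
    apply/negP => xy; move: hk; rewrite leqNgt -has_find => /hasPn /(_ _ yr).
    by rewrite xy.
  have [y /hx /ltnW //|T' [-> sT' E0 E1]] := @row_insert_append 1 x P sP.
  by left; split; rewrite ?E0 ?E1 ?nth_set_nth.
set y := nth 0 (row P 0) k.
have xy : x < y by apply: (nth_find 0); rewrite has_find.
have yr0 : y \in row P 0 by rewrite mem_nth.
have hy : {in row P 1, forall z, z < y}.
  move=> z zr; rewrite ltnNge; apply/negP => yz.
  have ur : uniq (row P 0 ++ row P 1) by rewrite (perm_uniq pm).
  have yz' : y < z.
    rewrite ltn_neqAle yz andbT; apply/eqP => E.
    by move: ur; rewrite cat_uniq => /and3P[_ /hasPn /(_ _ zr)]; rewrite -E yr0.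
  have [i [j [/andP[ij jw] h1 h2]]] := lo y z yr0 zr yz'.
  have iw := ltn_trans ij jw.
  by apply: (fw i j (size w)) => //; rewrite ?size_rcons ?nth_rcons ?iw ?jw
    ?ltnn ?eqxx //; lia.
have [|T' [-> sT' E0 E1]] := @row_insert_bump x P sP hk.
  by move=> z /hy /ltnW.
right; exists y; split=> //; rewrite ?E0 ?E1 ?nth_set_nth //.
- move=> v vr vy; rewrite ltn_neqAle; apply/andP; split.
    by apply: contraNneq xr0 => <-.
  have ik : index v (row P 0) < k.
    rewrite ltnNge; apply/negP => ki.
    have /(sorted_leq_nth leq_trans leqnn) H : sorted leq (row P 0).
      by apply: sub_sorted so => a b /ltnW.
    have := H 0 k (index v (row P 0)); rewrite !inE index_mem vr hk nth_index //.
    by move=> /(_ isT isT ki); rewrite -/y; lia.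
  by have := before_find 0 ik; rewrite nth_index // => /negbT; rewrite -leqNgt.
- rewrite set_nthE hk => v; rewrite mem_cat !inE.
  by move=> /or3P[/mem_take->|->//|/mem_drop->]; rewrite orbT.
Qed.

(* P1 and Q1 are aligned: the letter in position [nth 0 Q1 k] bumps
   [nth 0 P1 k] out of the first row. *)
Definition bump_matching (w P0 P1 Q1 : seq nat) :=
  [/\ forall k, k < size P1 -> [/\ nth 0 Q1 k < size w,
        nth 0 w (nth 0 Q1 k) < nth 0 P1 k & nth 0 P1 k \in take (nth 0 Q1 k) w],
      forall k v, k < size P1 -> v \in P0 -> v \in take (nth 0 Q1 k) w ->
        v < nth 0 P1 k -> v < nth 0 w (nth 0 Q1 k)
    & forall i j, i < j < size w -> j \notin Q1 -> nth 0 w j < nth 0 w i ->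
        exists k, [/\ k < size P1, nth 0 P1 k = nth 0 w i & nth 0 Q1 k < j]].

(** Induction on the last letter [x]. A letter never returns to the first row, so one that is there
    at the end was already there at each bump after its arrival; this gives the second clause. If
    [x] bumps nothing, it exceeds the first row, so every larger letter has been bumped before; this
    gives the third. *)
Lemma RSK_bump_matching w : uniq w -> free321 w ->
  bump_matching w (row (RSK w).1 0) (row (RSK w).1 1) (row (RSK w).2 1).
Proof.
elim/last_ind: w => [|w x IH] uw fw.
  by split=> // i j; rewrite ltn0 andbF.
have := RSK_rcons321 uw fw; move: uw; rewrite rcons_uniq => /andP[xw uw].
have fw' := free321_rcons fw; have := IH uw fw'.
have := rsk_invP uw fw'.
case: (RSK w) (RSK (rcons w x)) => [P Q] [P' Q'] /= inv [m1 m2 m3].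
have sPQ : size (row Q 1) = size (row P 1) by case: inv.
have mw y : (y \in w) = (y \in row P 0) || (y \in row P 1).
  by case: inv => _ _ pm _ _ _ _ _ _; rewrite -(perm_mem pm) mem_cat.
have nw i : i < size w -> nth 0 (rcons w x) i = nth 0 w i.
  by move=> iw; rewrite nth_rcons iw.
have tw i : i <= size w -> take i (rcons w x) = take i w.
  by move=> iw; rewrite -cats1 takel_cat.
case=> [[E0 E1 EQ r0x]|[y [yr xy yx] [E0 E1 EQ]]].
  rewrite E0 E1 EQ; split.
  - move=> k /[dup] kP /m1[zw h1 h2]; rewrite nw // (tw _ (ltnW zw)) size_rcons.
    by split=> //; rewrite ltnS ltnW.
  - move=> k v /[dup] kP /m1[zw h1 h2]; rewrite nw // (tw _ (ltnW zw)).
    rewrite mem_rcons inE => /orP[/eqP-> /mem_take|vP]; first by rewrite (negbTE xw).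
    exact: m2.
  - move=> i j /andP[ij]; rewrite size_rcons ltnS leq_eqVlt => /orP[/eqP Ej|jw] jQ.
      rewrite Ej nth_rcons ltnn eqxx nw -?Ej // => hx.
      have : nth 0 w i \in w by rewrite mem_nth // -Ej.
      rewrite mw => /orP[/r0x|]; first by lia.
      case/(nthP 0) => k kP Ek; exists k; split=> //.
      by have [] := m1 _ kP; rewrite Ej.
    rewrite !nw //; last exact: ltn_trans jw.
    by apply: m3; rewrite ?ij.
have nP k : k < size (row P 1) -> nth 0 (row P' 1) k = nth 0 (row P 1) k.
  by move=> kP; rewrite E1 nth_rcons kP.
have nQ k : k < size (row P 1) -> nth 0 (row Q' 1) k = nth 0 (row Q 1) k.
  by move=> kP; rewrite EQ nth_rcons sPQ kP.
have lP : nth 0 (row P' 1) (size (row P 1)) = y.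
  by rewrite E1 nth_rcons ltnn eqxx.
have lQ : nth 0 (row Q' 1) (size (row P 1)) = size w.
  by rewrite EQ nth_rcons -sPQ ltnn eqxx.
have lx : nth 0 (rcons w x) (size w) = x by rewrite nth_rcons ltnn eqxx.
have sP' : size (row P' 1) = (size (row P 1)).+1 by rewrite E1 size_rcons.
split; rewrite ?sP'.
- move=> k; rewrite ltnS leq_eqVlt => /orP[/eqP->|kP].
    rewrite lP lQ lx tw // take_size size_rcons; split=> //.
    by rewrite mw yr.
  have [zw h1 h2] := m1 _ kP; rewrite nP // nQ // nw // (tw _ (ltnW zw)) size_rcons.
  by split=> //; rewrite ltnS ltnW.
- move=> k v; rewrite ltnS leq_eqVlt => /orP[/eqP->|kP] /E0.
    rewrite lP lQ lx tw // take_size inE => /orP[/eqP->|]; first by rewrite (negbTE xw).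
    by move=> vP _; apply: yx.
  have [zw h1 h2] := m1 _ kP; rewrite nP // nQ // nw // (tw _ (ltnW zw)) inE.
  case/orP=> [/eqP-> /mem_take|vP]; first by rewrite (negbTE xw).
  exact: m2.
- move=> i j /andP[ij]; rewrite size_rcons ltnS EQ mem_rcons inE negb_or.
  move=> jw /andP[jne jQ]; have {}jw : j < size w by rewrite ltn_neqAle jne.
  rewrite !nw //; last exact: ltn_trans jw.
  move=> hx; have [|k [kP Ek zk]] := m3 i j _ jQ hx; first by rewrite ij.
  by exists k; rewrite nP // -EQ nQ // ltnS ltnW.
Qed.

(* The letter in position [z k] bumps the one in position [e k]. *)
Record matching (n : nat) (s : 'S_n) (m : nat) (e z : 'I_m -> 'I_n) : Prop :=
  Matching {
    mt_inje : injective e;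
    mt_injz : injective z;
    mt_lt : forall k, e k < z k;
    mt_gt : forall k, s (z k) < s (e k);
    mt_skip : forall k i, i \notin codom e -> i < z k -> s i < s (e k) ->
      s i < s (z k);
    mt_forced : forall i j : 'I_n, j \notin codom z -> i < j -> s j < s i ->
      exists2 k, e k = i & z k < j }.

(** * 321-avoiding permutations with a matching *)

Section Matching.

Variables (n : nat) (s : 'S_n).
Hypothesis s321 : forall i j k : 'I_n, i < j -> j < k -> s k < s j -> s j < s i -> False.

Lemma val_s_inj (i j : 'I_n) : s i = s j :> nat -> i = j.
Proof. by move/val_inj/perm_inj. Qed.

Lemma sum_s_lt v : v <= n -> \sum_(i < n) (s i < v) = v.
Proof. by move=> vn; rewrite (sum_perm s (fun x => (x < v) : nat)) sum_ord_lt. Qed.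

(** By avoidance all entries before [i] have values below [s i], and so has [j]: at least [i + 1]
    values. Dually, all values below [s j] occur before [j], and so does [s i]. *)
Lemma inversion_exc (i j : 'I_n) : i < j -> s j < s i -> i < s i /\ s j < j.
Proof.
move=> ij sij; split.
  rewrite -[X in _ <= X](sum_s_lt (ltnW (ltn_ord (s i)))) -(sum_ord_lt (ltnW (ltn_ord i))).
  rewrite -addn1 -(sum_eq1 j) -big_split; apply: leq_sum => k _ /=.
  case: (eqVneq k j) => [->|kj]; first by rewrite sij; lia.
  case: (ltnP k i) => //= ki; case: (ltngtP (s k) (s i)) => // [h|/val_s_inj E].
    by case: (@s321 k i j).
  by rewrite E ltnn in ki.
rewrite -[X in _ <= X](sum_ord_lt (ltnW (ltn_ord j))) -(sum_s_lt (ltnW (ltn_ord (s j)))).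
rewrite -addn1 -(sum_eq1 i) -big_split; apply: leq_sum => k _ /=.
case: (eqVneq k i) => [->|ki]; first by rewrite ij; lia.
case: (ltngtP k j) => [_|jk|/val_inj->]; rewrite ?ltnn ?addn0 ?leq_b1 //.
by case: (ltnP (s k) (s j)) => // h; case: (@s321 i j k).
Qed.

Lemma exc_mono (i j : 'I_n) : i < s i -> j < s j -> i < j -> s i < s j.
Proof.
move=> hi hj ij; case: (ltngtP (s i) (s j)) => // [h|/val_s_inj E].
  by have [] := inversion_exc ij h; lia.
by rewrite E ltnn in ij.
Qed.

Lemma nonexc_mono (i j : 'I_n) : s i <= i -> s j <= j -> i < j -> s i < s j.
Proof.
move=> hi hj ij; case: (ltngtP (s i) (s j)) => // [h|/val_s_inj E].
  by have [] := inversion_exc ij h; lia.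
by rewrite E ltnn in ij.
Qed.

Lemma invEE0 : invEE s = 0.
Proof.
apply: big1 => i _; apply: big1 => j _.
case: (ltnP i j) => //= ij; case: (ltnP (s j) (s i)) => //= h.
by have [] := inversion_exc ij h; lia.
Qed.

Lemma invNN0 : invNN s = 0.
Proof.
apply: big1 => i _; apply: big1 => j _.
case: (ltnP i j) => //= ij; case: (ltnP (s j) (s i)) => //= h.
by have [] := inversion_exc ij h; lia.
Qed.

Variables (m : nat) (e z : 'I_m -> 'I_n).
Hypothesis M : matching s e z.

(* [al i]: the letter in position i is bumped; [be i]: it bumps another one. *)
Local Notation al i := (i \in codom e).
Local Notation be i := (i \in codom z).

(** On the path, [cntP] counts the down-steps among the first [v] steps and [cntQ] the up-steps
    among the last [t]. Thus [k - 2 cntP k] and [k - 2 cntQ k] are the heights at distance [k <= n]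
    from the two ends. *)
Definition cntP v := \sum_(k < m) (s (e k) < v).
Definition cntQ t := \sum_(k < m) (z k < t).

Lemma sum_e f : \sum_(k < m) f (e k) = \sum_(i < n) al i * f i.
Proof. exact/sum_inj_codom/(mt_inje M). Qed.

Lemma sum_z f : \sum_(k < m) f (z k) = \sum_(i < n) be i * f i.
Proof. exact/sum_inj_codom/(mt_injz M). Qed.

Lemma e_exc k : e k < s (e k).
Proof. by have [] := inversion_exc (mt_lt M k) (mt_gt M k). Qed.

Lemma z_nonexc k : s (z k) < z k.
Proof. by have [] := inversion_exc (mt_lt M k) (mt_gt M k). Qed.

Lemma al_exc i : al i -> i < s i.
Proof. by case/codomP => k ->; apply: e_exc. Qed.

Lemma be_nonexc i : be i -> s i < i.
Proof. by case/codomP => k ->; apply: z_nonexc. Qed.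

(** * Unmatched excedances *)

Section Unmatched_exc.

Variable i : 'I_n.
Hypotheses (ial : ~~ al i) (iexc : i < s i).

Lemma e_neq k : s (e k) != s i :> nat.
Proof. by apply: contraNneq ial => /val_s_inj <-; apply: codom_f. Qed.

(** Excedances have increasing values, so [i] precedes [e k] and hence [z k]; [mt_skip] then
    applies, as [i] is never bumped. *)
Lemma z_above k : s i < s (e k) -> s i < s (z k).
Proof.
move=> h; apply: (mt_skip M) => //; apply: ltn_trans (mt_lt M k).
rewrite ltnNge; apply/negP; rewrite leq_eqVlt => /orP[/eqP/val_inj E|].
  by rewrite E ltnn in h.
by move/(exc_mono (e_exc k) iexc); lia.
Qed.

(** The left half stays above its height at [s i]: the interval from [s i] to [k - 1] contains [s i]
    and, for each bumped value strictly inside it, the value that bumps it. *)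
Lemma cntP_unmatched k : s i < k <= n -> (cntP k).*2 + s i < k + (cntP (s i)).*2.
Proof.
move=> /andP[vk kn].
pose L := \sum_(c < m) (s i < s (e c) < k).
have E1 : cntP k = cntP (s i) + L.
  rewrite -big_split; apply: eq_bigr => c _ /=; have := e_neq c; lia.
have L1 : L = \sum_j al j * (s i < s j < k).
  exact: (sum_e (fun j => (s i < s j < k) : nat)).
have L2 : L <= \sum_j be j * (s i < s j < k).
  rewrite -(sum_z (fun j => (s i < s j < k) : nat)); apply: leq_sum => c _.
  by have := @z_above c; have := mt_gt M c; lia.
have : 1 + (L + \sum_j be j * (s i < s j < k)) <= k - s i.
  rewrite L1 -(@sum_ord_itv n (s i) k kn) -(sum_perm s (fun x => (s i <= x < k) : nat)).
  rewrite -(sum_eq1 i) -!big_split; apply: leq_sum => j _ /=.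
  case: (eqVneq j i) => [->|ji]; first by rewrite ltnn /= !muln0; lia.
  case: (boolP (al j)) => [/al_exc|] ha; case: (boolP (be j)) => [/be_nonexc|] hb;
    by lia.
lia.
Qed.

(** The right half is also higher than the point [s i], up to and including the mirror image of that
    point. *)
Lemma cntQ_unmatched k : s i <= k <= n -> (cntQ k).*2 + s i < k + (cntP (s i)).*2.
Proof.
move=> /andP[vk kn].
pose L := \sum_(c < m) ((z c < k) && (s i < s (e c))).
have hL : cntQ k <= cntP (s i) + L.
  by rewrite -big_split; apply: leq_sum => c _ /=; have := e_neq c; lia.
case: (posnP L) => [L0|].
  rewrite L0 addn0 in hL; move: vk; rewrite leq_eqVlt => /orP[/eqP Ek|]; last by lia.
  (* Pigeonhole: the position [i] is below [s i] but its value is not. *)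
  have [j [h1 h2]] : exists j : 'I_n, s i <= j /\ s j < s i.
    case: (pickP (fun j : 'I_n => (s i <= j) && (s j < s i))) => [j /andP[]|no].
      by exists j.
    suff: s i + 1 <= s i by lia.
    rewrite -{1}(sum_s_lt (ltnW (ltn_ord (s i)))) -[X in _ <= X](sum_ord_lt (ltnW (ltn_ord (s i)))).
    rewrite -(sum_eq1 i) -big_split; apply: leq_sum => j _ /=.
    by have := no j; case: (eqVneq j i) => [->|_]; lia.
  (* Otherwise the inversion of [i] and [j] would force [i] to be bumped. The pair [c] with
     [z c = j] counts in [cntP (s i)] but not in [cntQ k], which makes the bound strict. *)
  have jbe : be j.
    apply/negPn/negP => jbe; have [|c ce _] := mt_forced M jbe _ h2; first by lia.
    by move: ial; rewrite -ce codom_f.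
  case/codomP: jbe => c Ej; rewrite Ej in h1 h2.
  suff: cntQ k + 1 <= cntP (s i) + L by lia.
  rewrite -(sum_eq1 c) -!big_split; apply: leq_sum => d _ /=.
  have := e_neq d; case: (eqVneq d c) => [->|_]; last by lia.
  by have := @z_above c; lia.
rewrite lt0n sum_nat_eq0 negb_forall => /existsP[c]; rewrite /= eqb0 negbK => /andP[c1 c2].
have L1 : L <= \sum_j al j * ((j < k) && (s i < s j)).
  rewrite -(sum_e (fun j => ((j < k) && (s i < s j)) : nat)); apply: leq_sum => d _.
  by have := mt_lt M d; lia.
have L2 : L <= \sum_j be j * ((j < k) && (s i < s j)).
  rewrite -(sum_z (fun j => ((j < k) && (s i < s j)) : nat)); apply: leq_sum => d _.
  by have := @z_above d; lia.
(* Once [L] is positive, all [s i + 1] entries of value at most [s i] lie before position [k], next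
   to the larger matched entries counted here. *)
suff : (s i).+1 + (\sum_j al j * ((j < k) && (s i < s j)) +
                   \sum_j be j * ((j < k) && (s i < s j))) <= k by lia.
rewrite -{1}(@sum_s_lt (s i).+1) // -[X in _ <= X](@sum_ord_lt n k) //.
rewrite -!big_split; apply: leq_sum => j _ /=.
have hj : s j <= s i -> j < k.
  case: (ltnP j (s j)) => hj hs; first by lia.
  suff : j < z c by lia.
  rewrite ltnNge; apply/negP; rewrite leq_eqVlt => /orP[/eqP/val_inj E|].
    by have := z_above c2; rewrite E; lia.
  move/(nonexc_mono (ltnW (z_nonexc c)) hj); have := z_above c2; lia.
case: (boolP (al j)) => [/al_exc|] ha; case: (boolP (be j)) => [/be_nonexc|] hb; lia.
Qed.

(** By [z_above], the two values of a matched pair lie on the same side of [s i]; so the smaller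
    values are those of [cntP (s i)] whole pairs and of unmatched entries. *)
Lemma value_unmatched :
  s i = (cntP (s i)).*2 + \sum_(j < n) (~~ al j && ~~ be j && (s j < s i)) :> nat.
Proof.
rewrite -{1}(sum_s_lt (ltnW (ltn_ord (s i)))).
have E1 : cntP (s i) = \sum_j al j * (s j < s i).
  exact: (sum_e (fun j => (s j < s i) : nat)).
have E2 : cntP (s i) = \sum_j be j * (s j < s i).
  rewrite -(sum_z (fun j => (s j < s i) : nat)); apply: eq_bigr => c _.
  by have := @z_above c; have := mt_gt M c; have := e_neq c; lia.
rewrite -addnn {1}E1 E2 -!big_split; apply: eq_bigr => j _ /=.
by case: (boolP (al j)) => [/al_exc|] ha; case: (boolP (be j)) => [/be_nonexc|] hb; lia.
Qed.

End Unmatched_exc.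

(** * Unmatched non-excedances *)

Section Unmatched_nonexc.

Variable j : 'I_n.
Hypotheses (jbe : ~~ be j) (jnon : s j <= j).

Lemma z_neq k : z k != j :> nat.
Proof. by apply: contraNneq jbe => /val_inj <-; apply: codom_f. Qed.

(** If [e k] came before [j], it would form an inversion with [j], and [mt_forced] would have it
    bumped before position [j], not at [z k]. *)
Lemma e_after k : j < z k -> j < e k.
Proof.
move=> h; rewrite ltnNge; apply/negP; rewrite leq_eqVlt => /orP[/eqP/val_inj E|h1].
  by have := e_exc k; rewrite E; lia.
have h2 := nonexc_mono jnon (ltnW (z_nonexc k)) h.
have [c /(mt_inje M) -> ] := mt_forced M jbe h1 (ltn_trans h2 (mt_gt M k)).
lia.
Qed.

(** This bound and the next are the analogues of [cntP_unmatched] and [cntQ_unmatched], with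
    positions and values exchanged and the path read from its right end. *)
Lemma cntQ_unmatched_nonexc k : j < k <= n -> (cntQ k).*2 + j < k + (cntQ j).*2.
Proof.
move=> /andP[vk kn].
pose L := \sum_(c < m) (j < z c < k).
have E1 : cntQ k = cntQ j + L.
  by rewrite -big_split; apply: eq_bigr => c _ /=; have := z_neq c; lia.
have L1 : L = \sum_i be i * (j < i < k).
  exact: (sum_z (fun i => (j < i < k) : nat)).
have L2 : L <= \sum_i al i * (j < i < k).
  rewrite -(sum_e (fun i => (j < i < k) : nat)); apply: leq_sum => c _.
  by have := @e_after c; have := mt_lt M c; lia.
have : 1 + (L + \sum_i al i * (j < i < k)) <= k - j.
  rewrite L1 -(@sum_ord_itv n j k kn).
  rewrite -(sum_eq1 j) -!big_split; apply: leq_sum => i _ /=.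
  case: (eqVneq i j) => [->|ji]; first by rewrite ltnn /= !muln0; lia.
  by case: (boolP (al i)) => [/al_exc|] ha; case: (boolP (be i)) => [/be_nonexc|] hb; lia.
lia.
Qed.

Lemma cntP_unmatched_nonexc k : j < k <= n -> (cntP k).*2 + j < k + (cntQ j).*2.
Proof.
move=> /andP[jk kn].
pose L := \sum_(c < m) ((s (e c) < k) && (j < z c)).
have hL : cntP k <= cntQ j + L.
  by rewrite -big_split; apply: leq_sum => c _ /=; have := z_neq c; lia.
case: (posnP L) => [L0|]; first by lia.
rewrite lt0n sum_nat_eq0 negb_forall => /existsP[c]; rewrite /= eqb0 negbK => /andP[c1 c2].
have L1 : L <= \sum_i al i * ((s i < k) && (j < i)).
  rewrite -(sum_e (fun i => ((s i < k) && (j < i)) : nat)); apply: leq_sum => d _.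
  by have := @e_after d; lia.
have L2 : L <= \sum_i be i * ((s i < k) && (j < i)).
  rewrite -(sum_z (fun i => ((s i < k) && (j < i)) : nat)); apply: leq_sum => d _.
  by have := mt_gt M d; lia.
suff : j.+1 + (\sum_i al i * ((s i < k) && (j < i)) +
                   \sum_i be i * ((s i < k) && (j < i))) <= k by lia.
rewrite -{1}(@sum_ord_lt n j.+1) // -[X in _ <= X](@sum_s_lt k) //.
rewrite -!big_split; apply: leq_sum => i _ /=.
have hi : i <= j -> s i < k.
  case: (ltnP i (s i)) => hi hs; last by lia.
  apply: ltn_trans c1; apply: exc_mono hi (e_exc c) _.
  by have := e_after c2; lia.
case: (boolP (al i)) => [/al_exc|] ha; case: (boolP (be i)) => [/be_nonexc|] hb; lia.
Qed.

(** A fixed point takes part in no inversion, so each bumped value is below [j] exactly when its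
    bumping position is. *)
Lemma cntP_fixed : s j = j :> nat -> cntP j = cntQ j.
Proof.
move=> fj; apply: eq_bigr => c _.
have h1 := @e_after c; have h2 := e_exc c; have h3 := z_neq c; have h4 := mt_lt M c.
suff : z c < j -> s (e c) < j by lia.
move=> zj; rewrite ltnNge; apply/negP; rewrite leq_eqVlt => /orP[/eqP E|h].
  have E' : e c = j by apply: val_s_inj; rewrite fj.
  by move: h4 zj; rewrite E'; lia.
by have [] := @inversion_exc (e c) j; rewrite ?fj; lia.
Qed.

(** Since [s j] is below [j], some entry before [j] has a value at least [j]. It is bumped before
    [j], so its pair counts only in [cntQ j]. *)
Lemma cntP_nonfixed : s j < j -> cntP j < cntQ j.
Proof.
move=> sj.
have [i [h1 h2]] : exists i : 'I_n, i < j /\ j <= s i.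
  case: (pickP (fun i : 'I_n => (i < j) && (j <= s i))) => [i /andP[]|no].
    by exists i.
  suff: j + 1 <= j by lia.
  rewrite -{1}(sum_ord_lt (ltnW (ltn_ord j))) -[X in _ <= X](sum_s_lt (ltnW (ltn_ord j))).
  rewrite -(sum_eq1 j) -big_split; apply: leq_sum => i _ /=.
  by have := no i; case: (eqVneq i j) => [->|_]; lia.
have [c ce zc] := mt_forced M jbe h1 (leq_trans sj h2).
rewrite -addn1 -(sum_eq1 c) -big_split; apply: leq_sum => d _ /=.
have := @e_after d; have := e_exc d; have := z_neq d; have := mt_lt M d.
by case: (eqVneq d c) => [->|_]; rewrite ?ce; lia.
Qed.

Lemma position_unmatched :
  j = (cntQ j).*2 + \sum_(i < n) (~~ al i && ~~ be i && (i < j)) :> nat.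
Proof.
rewrite -{1}(sum_ord_lt (ltnW (ltn_ord j))).
have E1 : cntQ j = \sum_i be i * (i < j).
  exact: (sum_z (fun i => (i < j) : nat)).
have E2 : cntQ j = \sum_i al i * (i < j).
  rewrite -(sum_e (fun i => (i < j) : nat)); apply: eq_bigr => c _.
  by have := @e_after c; have := mt_lt M c; have := z_neq c; lia.
rewrite -addnn {1}E1 E2 -!big_split; apply: eq_bigr => i _ /=.
by case: (boolP (al i)) => [/al_exc|] ha; case: (boolP (be i)) => [/be_nonexc|] hb; lia.
Qed.

End Unmatched_nonexc.

(** * Counting pairs of unmatched entries *)

Let un i := ~~ al i && ~~ be i.

Let H := \sum_(i < n) un i.

Lemma sum_al : \sum_(i < n) al i = m.
Proof.
have m1 : \sum_(k < m) 1 = m by rewrite sum1_card card_ord.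
by rewrite -[RHS]m1 (sum_e (fun=> 1)); apply: eq_bigr => i _; rewrite muln1.
Qed.

Lemma sum_be : \sum_(i < n) be i = m.
Proof.
have m1 : \sum_(k < m) 1 = m by rewrite sum1_card card_ord.
by rewrite -[RHS]m1 (sum_z (fun=> 1)); apply: eq_bigr => i _; rewrite muln1.
Qed.

Lemma card_unmatched : H + m.*2 = n.
Proof.
have n1 : \sum_(k < n) 1 = n by rewrite sum1_card card_ord.
rewrite -addnn -[X in X + m]sum_al -[X in _ + (_ + X)]sum_be -[RHS]n1 -!big_split.
apply: eq_bigr => i _ /=; rewrite /un.
by case: (boolP (al i)) => [/al_exc|] ha; case: (boolP (be i)) => [/be_nonexc|] hb; lia.
Qed.

(* An excedance is compared with any other entry by value, a non-excedance by
   position; of two unmatched entries, exactly one is below the other. *)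
Let below (i j : 'I_n) := if i < s i then s j < s i else j < i.

Lemma sum_below_unmatched :
  (\sum_(i < n) \sum_(j < n) [&& un i, un j & below i j]).*2 + H = H * H.
Proof.
have -> : H * H = \sum_(i < n) \sum_(j < n) (un i && un j).
  rewrite /H big_distrl; apply: eq_bigr => i _; rewrite big_distrr /=.
  by apply: eq_bigr => j _; case: (un i); case: (un j).
rewrite -addnn {1}exchange_big -!big_split /=; apply: eq_bigr => i _.
have -> : (un i : nat) = \sum_(j < n) (j == i) * un i.
  by rewrite -big_distrl /= sum_eq1 mul1n.
rewrite -!big_split /=; apply: eq_bigr => j _.
case: (boolP (un i)) => ui; last by rewrite andbF muln0.
case: (boolP (un j)) => uj /=; last first.
  by case: (eqVneq j i) uj => [->|//]; rewrite ui.
case: (eqVneq j i) => [->|ji]; first by rewrite /below !ltnn; case: ifP.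
have sji : s j != s i :> nat by apply: contraNneq ji => /val_s_inj ->.
have {}ji : j != i :> nat by [].
(* Both inequalities together would be an inversion, making [a] bumped; if both failed, then
   [b >= s b > s a > a > b]. *)
have mixed (a b : 'I_n) : un a -> un b -> a < s a -> s b <= b ->
    (s b < s a) + (a < b) = 1.
  move=> /andP[aa _] /andP[_ bb] ha hb.
  suff : ~ (s b < s a /\ a < b) by lia.
  case=> h1 h2; have [k ke _] := mt_forced M bb h2 h1.
  by move: aa; rewrite -ke codom_f.
rewrite /below; have := mixed i j ui uj; have := mixed j i uj ui.
by case: (ltnP i (s i)) => hi; case: (ltnP j (s j)) => hj; lia.
Qed.

(** The counterpart of [crs_path] for [s], whose first sum is [crs s + exc s] since [invEE s] and
    [invNN s] vanish. *)
Lemma sum_matching :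
  \sum_(i < n) (s i - i) + \sum_(i < n) ~~ al i * cntP (s i) + \sum_(i < n) ~~ be i * cntQ i
  = m * m + (\sum_(i < n) (~~ al i && (i < s i)) * cntP (s i)).*2
          + (\sum_(i < n) (~~ be i && (s i <= i)) * cntQ i).*2.
Proof.
set XP := \sum_(i < n) ~~ al i * _; set XQ := \sum_(i < n) ~~ be i * _.
set EP := \sum_(i < n) (~~ al i && _) * _; set EQ := \sum_(i < n) (~~ be i && _) * _.
have hP : (XP + \sum_(k < m) s (e k)).*2 + m * m + m = (m * n).*2.
  have inj : injective (fun k => s (e k)) by move=> k l /perm_inj /(mt_inje M).
  rewrite -(sum_below_codomC inj); congr ((_ + _).*2 + _ + _).
  rewrite -(sum_perm s); apply: eq_bigr => i _; congr (~~ _ * _).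
  apply/codomP/codomP => [[k ->]|[k /perm_inj ->]]; by exists k.
have hQ : (XQ + \sum_(k < m) z k).*2 + m * m + m = (m * n).*2.
  by rewrite -(sum_below_codomC (mt_injz M)).
pose W := \sum_(i < n) \sum_(j < n) [&& un i, un j & below i j].
pose UE := \sum_(i < n) (~~ al i && (i < s i)) * s i.
pose UN := \sum_(i < n) (~~ be i && (s i <= i)) * i.
(* Sum of [value_unmatched] over the unmatched excedances and of [position_unmatched] over the
   unmatched non-excedances. *)
have hU : UE + UN = EP.*2 + EQ.*2 + W.
  rewrite -!muln2 !big_distrl -!big_split; apply: eq_bigr => i _ /=.
  case: (ltnP i (s i)) => hi; rewrite ?andbT ?andbF ?mul0n ?addn0 /=.
    case: (boolP (al i)) => ai; first by rewrite !mul0n big1 // => j; rewrite /un ai.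
    rewrite !mul1n {1}(value_unmatched ai hi) muln2; congr (_ + _).
    apply: eq_bigr => j _; rewrite /un /below ai hi /=.
    by case: (boolP (be i)) => [/be_nonexc|_] //=; lia.
  case: (boolP (be i)) => bi.
    by rewrite !mul0n big1 // => j; rewrite /un bi andbF.
  rewrite !mul1n {1}(position_unmatched bi hi) muln2 !add0n; congr (_ + _).
  apply: eq_bigr => j _; rewrite /un /below bi [i < s i]ltnNge hi /= andbT.
  by case: (boolP (al i)) => [/al_exc|_] //=; lia.
have hE : UE + \sum_(k < m) s (e k) = \sum_(i < n) (i < s i) * s i.
  rewrite (sum_e (fun i => s i : nat)) -big_split; apply: eq_bigr => i _ /=.
  by case: (boolP (al i)) => [/al_exc ->|_] /=; lia.
have hN : UN + \sum_(k < m) z k = \sum_(i < n) (s i <= i) * i.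
  rewrite (sum_z (fun i => i : nat)) -big_split; apply: eq_bigr => i _ /=.
  by case: (boolP (be i)) => [/be_nonexc|_] /=; case: leqP; lia.
have hS : \sum_(i < n) (i < s i) * s i + \sum_(i < n) (s i <= i) * i =
    \sum_(i < n) (s i - i) + \sum_(i < n) i.
  by rewrite -!big_split; apply: eq_bigr => i _ /=; case: leqP; lia.
have hT : (\sum_(i < n) i).*2 + n = n * n.
  have := @sum_asym_rel 'I_n (fun i j : 'I_n => j < i); rewrite card_ord => <-.
  - congr (_.*2 + _); apply: eq_bigr => i _.
    by rewrite (sum_ord_lt (ltnW (ltn_ord i))).
  - by move=> i; rewrite ltnn.
  - by move=> i j ij; have {}ij : i != j :> nat by []; lia.
have hW : W.*2 + H = H * H := sum_below_unmatched.
have hn := card_unmatched.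
move: hP hQ hU hE hN hS hT hW.
move: (\sum_(k < m) s (e k)) (\sum_(k < m) z k) (\sum_(i < n) (i < s i) * s i).
move: (\sum_(i < n) (s i <= i) * i) (\sum_(i < n) (s i - i)) (\sum_(i < n) i).
move: H XP XQ EP EQ W UE UN hn => h xp xq ep eq w ue un' hn a b c d f g.
(* With [n = h + 2m] substituted, a polynomial identity in [h] and [m] remains, linear in the other
   sums. *)
rewrite -!hn; nia.
Qed.

(** * The arcs of the path attached to the matching *)

Section Path.

Variable D : seq bool.
Hypothesis DyckD : Dyck n D.

Hypothesis D_left : forall i, nth false D (s i) = ~~ al i.
Hypothesis D_right : forall j : 'I_n, nth false D (n.*2.-1 - j) = be j.

Let pi := Phi_inv n D.
Let p := @upos n D.
Let q := @dpos n D.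

Lemma sum_up_steps (f : nat -> nat) : \sum_(u < n.*2) nth false D u * f u =
  \sum_(i < n) ~~ al i * f (s i) + \sum_(j < n) be j * f (n.*2.-1 - j).
Proof.
rewrite (sum_double n (fun u => nth false D u * f u)); congr (_ + _).
  rewrite -(sum_perm s (fun i => nth false D i * f i)).
  by apply: eq_bigr => i _; rewrite D_left.
by apply: eq_bigr => i _; rewrite D_right.
Qed.

Lemma sum_down_steps (f : nat -> nat) : \sum_(u < n.*2) ~~ nth false D u * f u =
  \sum_(i < n) al i * f (s i) + \sum_(j < n) ~~ be j * f (n.*2.-1 - j).
Proof.
rewrite (sum_double n (fun u => ~~ nth false D u * f u)); congr (_ + _).
  rewrite -(sum_perm s (fun i => ~~ nth false D i * f i)).
  by apply: eq_bigr => i _; rewrite D_left negbK.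
by apply: eq_bigr => i _; rewrite D_right.
Qed.

Lemma sum_p (f : nat -> nat) : \sum_a f (p a) =
  \sum_(i < n) ~~ al i * f (s i) + \sum_(j < n) be j * f (n.*2.-1 - j).
Proof. by rewrite (sum_upos DyckD) sum_up_steps. Qed.

Lemma sum_q (f : nat -> nat) : \sum_a f (q a) =
  \sum_(i < n) al i * f (s i) + \sum_(j < n) ~~ be j * f (n.*2.-1 - j).
Proof. by rewrite (sum_dpos DyckD) sum_down_steps. Qed.

Lemma height_left k : k <= n -> height D k = (k%:Z - (cntP k).*2%:Z)%R.
Proof.
move=> kn; have kn2 : k <= n.*2 by lia.
have E : ups D k + cntP k = k.
  rewrite (ups_sum DyckD) // (sum_up_steps (fun u => (u < k) : nat)).
  rewrite [X in _ + X + _]big1 ?addn0; last first.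
    by move=> j _; have := ltn_ord j; lia.
  rewrite /cntP (sum_e (fun i => (s i < k) : nat)) -big_split -[RHS](@sum_s_lt k) //.
  by apply: eq_bigr => i _ /=; rewrite -mulnDl; case: (al i); rewrite mul1n.
have := ups_downs DyckD kn2; rewrite /height -/(ups D k) -/(downs D k); lia.
Qed.

Lemma height_right k : k <= n -> height D (n.*2 - k) = (k%:Z - (cntQ k).*2%:Z)%R.
Proof.
move=> kn; have kn2 : n.*2 - k <= n.*2 by lia.
have E : ups D (n.*2 - k) + cntQ k = n.
  have n1 : \sum_(i < n) 1 = n by rewrite sum1_card card_ord.
  rewrite (ups_sum DyckD) // (sum_up_steps (fun u => (u < n.*2 - k) : nat)).
  rewrite /cntQ (sum_z (fun i => (i < k) : nat)) -addnA -big_split /=.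
  rewrite (eq_bigr (fun i => ~~ al i : nat)); last first.
    by move=> i _; have := ltn_ord (s i); case: (al i) => /=; lia.
  rewrite [X in _ + X](eq_bigr (fun i => be i : nat)); last first.
    by move=> i _; have := ltn_ord i; case: (be i) => /=; lia.
  rewrite sum_be -[X in _ + X = _]sum_al -big_split -[RHS]n1.
  by apply: eq_bigr => i _ /=; case: (al i).
have := ups_downs DyckD kn2; rewrite /height -/(ups D _) -/(downs D _); lia.
Qed.

(** The path cannot return to its height at [s i] before passing the mirror image of that point, by
    [cntP_unmatched] and [cntQ_unmatched]. *)
Lemma arc_exc i : ~~ al i -> i < s i -> exists2 a, p a = s i & n.*2 <= p a + q a.
Proof.
move=> ai hi; have sn := ltn_ord (s i).
have [||a pa] := @upos_surj _ _ DyckD (s i); [by lia | by rewrite D_left |].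
exists a => //; have [/andP[pq qn] _ _ hq _] := dpos_spec DyckD a.
rewrite -/(p a) -/(q a) in pa pq qn hq *; rewrite pa in pq hq *.
rewrite leqNgt; apply/negP => h.
have : (height D (s i) < height D (q a).+1)%R; last by rewrite hq ltxx.
rewrite (height_left (ltnW sn)).
case: (leqP (q a).+1 n) => qn'.
  rewrite height_left //; have := @cntP_unmatched i ai hi (q a).+1.
  by lia.
have -> : (q a).+1 = n.*2 - (n.*2 - (q a).+1) by lia.
rewrite height_right; last by lia.
by have := @cntQ_unmatched i ai hi (n.*2 - (q a).+1); lia.
Qed.

(** Seen backwards from its end, the arc cannot close before abscissa [j]. The heights at [j] and at
    its mirror image agree if [j] is fixed and differ otherwise, by [cntP_fixed] and
    [cntP_nonfixed]. *)
Lemma arc_nonexc j : ~~ be j -> s j <= j ->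
  exists a, [/\ q a = n.*2.-1 - j, p a <= j & (p a == j) = (s j == j)].
Proof.
move=> bj hj; have jn := ltn_ord j.
have [||a qa] := @dpos_surj _ _ DyckD (n.*2.-1 - j); [by lia | by rewrite D_right |].
have [/andP[pq qn] _ _ hq hm] := dpos_spec DyckD a.
exists a; rewrite -/(p a) -/(q a) in pq qn hq hm qa *.
have hr : height D (p a) = (j%:Z - (cntQ j).*2%:Z)%R.
  by rewrite -hq -height_right 1?ltnW // qa; congr height; lia.
have paj : p a <= j.
  rewrite leqNgt; apply/negP => h.
  suff : (j%:Z - (cntQ j).*2%:Z < height D (p a))%R by rewrite hr ltxx.
  case: (leqP (p a) n) => pn.
    rewrite height_left //.
    by have := @cntP_unmatched_nonexc j bj hj (p a); lia.
  have -> : p a = n.*2 - (n.*2 - p a) by lia.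
  rewrite height_right; last by lia.
  by have := @cntQ_unmatched_nonexc j bj hj (n.*2 - p a); lia.
have hl := height_left (ltnW jn).
split=> //; apply/eqP/eqP => [E|sj].
  move: hj; rewrite leq_eqVlt => /orP[/eqP/val_inj //|h].
  by have := cntP_nonfixed bj (ltnW h) h; move: hr; rewrite E hl; lia.
move: paj; rewrite leq_eqVlt => /orP[/eqP //|h].
have sj' : s j = j :> nat by rewrite sj.
have := hm j; have := cntP_fixed bj hj sj'; rewrite hr hl h; lia.
Qed.

(** The side of an arc's centre is made a property of one end step, so that [sum_p] and [sum_q]
    apply; a centre in the middle falls under [left_down]. *)
Definition right_up u := [exists a, (p a == u) && (n.*2 <= p a + q a)].
Definition left_down u := [exists a, (q a == u) && (p a + q a < n.*2)].

Lemma right_upE a : right_up (p a) = (n.*2 <= p a + q a).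
Proof.
apply/existsP/idP => [[b /andP[/eqP /(upos_inj DyckD) -> //]]|h].
by exists a; rewrite eqxx.
Qed.

Lemma left_downE a : left_down (q a) = (p a + q a < n.*2).
Proof.
apply/existsP/idP => [[b /andP[/eqP /(dpos_inj DyckD) -> //]]|h].
by exists a; rewrite eqxx.
Qed.

Lemma arc_lt a : p a < q a < n.*2.
Proof. by have [] := dpos_spec DyckD a. Qed.

Lemma sum_right_through (f : nat -> nat) : \sum_a ((p a < n) && (n.*2 <= p a + q a)) * f (p a) =
  \sum_(i < n) (~~ al i && right_up (s i)) * f (s i).
Proof.
transitivity (\sum_a ((p a < n) && right_up (p a)) * f (p a)).
  by apply: eq_bigr => a _; rewrite right_upE.
rewrite (sum_p (fun u => ((u < n) && right_up u) * f u)) [X in _ + X]big1 ?addn0.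
  by apply: eq_bigr => i _; rewrite ltn_ord mulnA mulnb.
move=> j _; rewrite (_ : _ < n = false) ?muln0 //.
by have := ltn_ord j; lia.
Qed.

Lemma sum_left_through (f : nat -> nat) : \sum_a ((n <= q a) && (p a + q a < n.*2)) * f (q a) =
  \sum_(j < n) (~~ be j && left_down (n.*2.-1 - j)) * f (n.*2.-1 - j).
Proof.
transitivity (\sum_a ((n <= q a) && left_down (q a)) * f (q a)).
  by apply: eq_bigr => a _; rewrite left_downE.
rewrite (sum_q (fun u => ((n <= u) && left_down u) * f u)) big1 ?add0n.
  apply: eq_bigr => j _; rewrite (_ : n <= _) ?mulnA ?mulnb //.
  by have := ltn_ord j; lia.
by move=> i _; rewrite leqNgt ltn_ord /= muln0.
Qed.

Lemma sum_right_half : \sum_a (n <= p a) = m.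
Proof.
rewrite (sum_p (fun u => (n <= u) : nat)) big1 ?add0n.
  rewrite -[RHS]sum_be; apply: eq_bigr => j _.
  by have := ltn_ord j; case: (be j) => /=; lia.
by move=> i _; rewrite leqNgt ltn_ord muln0.
Qed.

Lemma sum_left_half : \sum_a (q a < n) = m.
Proof.
rewrite (sum_q (fun u => (u < n) : nat)) [X in _ + X]big1 ?addn0.
  by rewrite -[RHS]sum_al; apply: eq_bigr => i _; rewrite ltn_ord muln1.
by move=> j _; have := ltn_ord j; lia.
Qed.

Lemma exc_path : exc pi = \sum_a (n.*2 <= p a + q a).
Proof.
by rewrite /exc card_set_sum; apply: eq_bigr => a _; rewrite (exc_arcs DyckD).
Qed.

Lemma exc_split : exc s = \sum_(i < n) (~~ al i && (i < s i)) + m.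
Proof.
rewrite /exc card_set_sum -[X in _ = _ + X]sum_al -big_split; apply: eq_bigr => i _ /=.
by case: (boolP (al i)) => [/al_exc -> //|_]; rewrite addn0.
Qed.

Lemma nonexc_split : exc s + \sum_(j < n) (~~ be j && (s j <= j)) + m = n.
Proof.
have n1 : \sum_(i < n) 1 = n by rewrite sum1_card card_ord.
rewrite /exc card_set_sum -[RHS]n1 -[X in _ + X = _]sum_be -!big_split.
apply: eq_bigr => i _ /=.
by case: (boolP (be i)) => [/be_nonexc|_] /=; lia.
Qed.

(** The arcs centred to the right are the [m] arcs inside the right half and some of those joining
    the halves. *)
Lemma exc_path_split : exc pi = \sum_(i < n) (~~ al i && right_up (s i)) + m.
Proof.
have := sum_right_through (fun=> 1).
rewrite [in RHS](eq_bigr (fun i : 'I_n => (~~ al i && right_up (s i)) : nat));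
  last by move=> i _; rewrite muln1.
move=> <-; rewrite exc_path -[X in _ = _ + X]sum_right_half -big_split.
by apply: eq_bigr => a _ /=; have := arc_lt a; lia.
Qed.

Lemma nonexc_path_split :
  exc pi + \sum_(j < n) (~~ be j && left_down (n.*2.-1 - j)) + m = n.
Proof.
have := sum_left_through (fun=> 1).
rewrite [in RHS](eq_bigr (fun j : 'I_n => (~~ be j && left_down (n.*2.-1 - j)) : nat));
  last by move=> i _; rewrite muln1.
have n1 : \sum_(i < n) 1 = n by rewrite sum1_card card_ord.
move=> <-; rewrite exc_path -[X in _ + X = _]sum_left_half -[RHS]n1 -!big_split.
by apply: eq_bigr => a _ /=; have := arc_lt a; lia.
Qed.

Lemma exc_le_right_up (i : 'I_n) : ~~ al i && (i < s i) <= ~~ al i && right_up (s i).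
Proof.
case: (boolP (~~ al i && (i < s i))) => // /andP[ai hi]; rewrite ai.
have [a pa h] := arc_exc ai hi.
by rewrite -pa right_upE h.
Qed.

Lemma nonexc_le_left_down (j : 'I_n) :
  ~~ be j && (s j <= j) <= ~~ be j && left_down (n.*2.-1 - j).
Proof.
case: (boolP (~~ be j && (s j <= j))) => // /andP[bj hj]; rewrite bj.
have [a [qa h _]] := arc_nonexc bj hj; have jn := ltn_ord j.
by rewrite -qa left_downE qa (_ : _ < _) //; lia.
Qed.

(** Unmatched excedances and non-excedances inject into the joining arcs of the two kinds. Both
    totals are [n - 2m], so both inequalities are equalities. *)
Lemma exc_preserved : exc pi = exc s.
Proof.
have h1 : \sum_(i < n) (~~ al i && (i < s i)) <= \sum_(i < n) (~~ al i && right_up (s i)).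
  by apply: leq_sum => i _; apply: exc_le_right_up.
have h2 : \sum_(j < n) (~~ be j && (s j <= j)) <=
          \sum_(j < n) (~~ be j && left_down (n.*2.-1 - j)).
  by apply: leq_sum => i _; apply: nonexc_le_left_down.
have := exc_split; have := nonexc_split.
have := exc_path_split; have := nonexc_path_split; lia.
Qed.

Lemma right_up_exc (i : 'I_n) : ~~ al i && (i < s i) = ~~ al i && right_up (s i).
Proof.
have := eq_of_leq_sum exc_le_right_up; rewrite /= => h.
have /h/(_ i) : \sum_(i < n) (~~ al i && right_up (s i)) <=
    \sum_(i < n) (~~ al i && (i < s i)).
  by have := exc_split; have := exc_path_split; have := exc_preserved; lia.
by case: (_ && _); case: (_ && _).
Qed.

Lemma left_down_nonexc (j : 'I_n) :
  ~~ be j && (s j <= j) = ~~ be j && left_down (n.*2.-1 - j).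
Proof.
have := eq_of_leq_sum nonexc_le_left_down; rewrite /= => h.
have /h/(_ j) : \sum_(j < n) (~~ be j && left_down (n.*2.-1 - j)) <=
    \sum_(j < n) (~~ be j && (s j <= j)).
  by have := nonexc_split; have := nonexc_path_split; have := exc_preserved; lia.
by case: (_ && _); case: (_ && _).
Qed.

Lemma fp_preserved : fp pi = fp s.
Proof.
pose phi u := (n <= u) && [exists a, (q a == u) && (p a + q a + 1 == n.*2)].
have -> : fp pi = \sum_a phi (q a).
  rewrite /fp card_set_sum; apply: eq_bigr => a _; rewrite (fp_arcs DyckD); congr nat_of_bool.
  rewrite /phi -/(p a) -/(q a); have h := arc_lt a; apply/idP/andP => [h1|[_]].
    by split; [lia | apply/existsP; exists a; rewrite eqxx].
  by case/existsP => b /andP[/eqP /(dpos_inj DyckD) ->].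
rewrite (sum_q (fun u => phi u : nat)) big1 ?add0n; last first.
  by move=> i _; rewrite /phi leqNgt ltn_ord muln0.
rewrite /fp card_set_sum; apply: eq_bigr => j _; have jn := ltn_ord j.
case: (boolP (be j)) => [/be_nonexc|bj] /=.
  by move=> h; rewrite -(inj_eq val_inj) /= (ltn_eqF h).
rewrite mul1n; congr nat_of_bool.
have hn : n <= n.*2.-1 - j by lia.
rewrite /phi hn /=; case: (leqP (s j) j) => hj.
  have [a [qa pa pj]] := arc_nonexc bj hj; rewrite -pj.
  apply/existsP/idP => [[b /andP[/eqP qb]]|/eqP E].
    by rewrite (dpos_inj DyckD (etrans qb (esym qa))); lia.
  by exists a; rewrite qa eqxx /= E; lia.
(* If [j] is an excedance, the arc ending at its mirror image is centred to the right, hence not in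
   the middle. *)
have := left_down_nonexc j; rewrite bj leqNgt hj /= => /esym/negbT.
rewrite -(inj_eq val_inj) /= (gtn_eqF hj) => ld; apply: contraNF ld.
case/existsP => b /andP[qb E]; apply/existsP; exists b; rewrite qb /=; lia.
Qed.

Lemma sum_downs_before u : u <= n -> \sum_b (q b < u) = cntP u.
Proof.
move=> hu; rewrite (sum_q (fun v => (v < u) : nat)) [X in _ + X]big1 ?addn0.
  by rewrite /cntP (sum_e (fun i => (s i < u) : nat)).
by move=> j _; have := ltn_ord j; lia.
Qed.

Lemma sum_ups_after u : n <= u < n.*2 -> \sum_a (u < p a) = cntQ (n.*2.-1 - u).
Proof.
move=> hu; rewrite (sum_p (fun v => (u < v) : nat)) big1 ?add0n.
  rewrite /cntQ (sum_z (fun j => (j < n.*2.-1 - u) : nat)).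
  by apply: eq_bigr => j _; congr (_ * _); lia.
by move=> i _; have := ltn_ord (s i); lia.
Qed.

(** Inversions of [pi] are pairs of disjoint arcs, counted according to the halves containing [q b]
    and [p a]. *)
Lemma crs_path : crs pi + exc pi +
    \sum_(i < n) ~~ al i * cntP (s i) + \sum_(i < n) ~~ be i * cntQ i
  = m * m + (\sum_(i < n) (~~ al i && (i < s i)) * cntP (s i)).*2
          + (\sum_(i < n) (~~ be i && (s i <= i)) * cntQ i).*2.
Proof.
have T1 : \sum_a \sum_b (q b < p a < n) = \sum_(i < n) ~~ al i * cntP (s i).
  transitivity (\sum_a (p a < n) * cntP (p a)).
    apply: eq_bigr => a _; case: (ltnP (p a) n) => pn.
      rewrite mul1n -(sum_downs_before (ltnW pn)).
      by apply: eq_bigr => b _; rewrite andbT.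
    by rewrite big1 // => b _; rewrite andbF.
  rewrite (sum_p (fun u => (u < n) * cntP u)) [X in _ + X]big1 ?addn0.
    by apply: eq_bigr => i _; rewrite ltn_ord mul1n.
  by move=> j _; rewrite (_ : _ < n = false) ?muln0 //; have := ltn_ord j; lia.
have T2 : \sum_a \sum_b (n <= q b < p a) = \sum_(i < n) ~~ be i * cntQ i.
  rewrite exchange_big; transitivity (\sum_b (n <= q b) * cntQ (n.*2.-1 - q b)).
    apply: eq_bigr => b _; case: (leqP n (q b)) => qn.
      rewrite mul1n -sum_ups_after //.
      by have := arc_lt b; lia.
    by rewrite big1.
  rewrite (sum_q (fun u => (n <= u) * cntQ (n.*2.-1 - u))) big1 ?add0n.
    apply: eq_bigr => j _; have jn := ltn_ord j.
    rewrite (_ : n <= _); last by lia.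
    by rewrite mul1n subKn //; lia.
  by move=> i _; rewrite leqNgt ltn_ord muln0.
have T3 : \sum_a \sum_b (q b < n <= p a) = m * m.
  rewrite -{1}sum_right_half big_distrl; apply: eq_bigr => a _ /=.
  rewrite -sum_left_half big_distrr; apply: eq_bigr => b _ /=.
  by case: (_ < n); case: (n <= _).
have T4 : \sum_a \sum_b ((q b < p a < n) && (n.*2 <= p a + q a)) =
          \sum_(i < n) (~~ al i && (i < s i)) * cntP (s i).
  transitivity (\sum_a ((p a < n) && (n.*2 <= p a + q a)) * cntP (p a)).
    apply: eq_bigr => a _; case: (ltnP (p a) n) => pn /=.
      rewrite -(sum_downs_before (ltnW pn)) big_distrr; apply: eq_bigr => b _ /=.
      by rewrite andbT andbC mulnb.
    by rewrite big1 // => b _; rewrite andbF.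
  rewrite sum_right_through; apply: eq_bigr => i _.
  by rewrite right_up_exc.
have T5 : \sum_a \sum_b ((n <= q b < p a) && (p b + q b < n.*2)) =
          \sum_(i < n) (~~ be i && (s i <= i)) * cntQ i.
  rewrite exchange_big.
  transitivity (\sum_b ((n <= q b) && (p b + q b < n.*2)) * cntQ (n.*2.-1 - q b)).
    apply: eq_bigr => b _; case: (leqP n (q b)) => qn /=; last by rewrite big1.
    rewrite -sum_ups_after; last by have := arc_lt b; lia.
    rewrite big_distrr; apply: eq_bigr => a _ /=.
    by rewrite andbC mulnb.
  rewrite (sum_left_through (fun u => cntQ (n.*2.-1 - u))); apply: eq_bigr => j _.
  have jn := ltn_ord j.
  by rewrite left_down_nonexc subKn //; lia.
(* This holds pair by pair. For [q b < n <= p a] the inversion is EN. For [p a < n] the arc [b] is a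
   non-excedance, so the type is EN or NN according to [a]; for [n <= q b] the arc [a] is an
   excedance, so it is EN or EE according to [b]. *)
have key : invEN pi + \sum_a \sum_b (q b < p a < n) + \sum_a \sum_b (n <= q b < p a) =
    invEE pi + invNN pi + \sum_a \sum_b (q b < n <= p a) +
    (\sum_a \sum_b ((q b < p a < n) && (n.*2 <= p a + q a))).*2 +
    (\sum_a \sum_b ((n <= q b < p a) && (p b + q b < n.*2))).*2.
  rewrite -!addnn -!big_split; apply: eq_bigr => a _.
  rewrite -!big_split; apply: eq_bigr => b _ /=.
  have hi := inversion_arcs DyckD a b.
  have ha := exc_arcs DyckD a; have hb := exc_arcs DyckD b.
  rewrite -/pi -/(p a) -/(q a) -/(p b) -/(q b) in hi ha hb *.
  rewrite !(andbA (a < b)) hi ha hb [pi a <= a]leqNgt ha [pi b <= b]leqNgt hb.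
  have := arc_lt a; have := arc_lt b; lia.
have := crs_exc_sum pi; rewrite sum_exc_invEN; move: key.
by rewrite T1 T2 T3 T4 T5; lia.
Qed.

Lemma crs_preserved : crs pi = crs s.
Proof.
have := sum_matching; have := crs_path; have := crs_exc_sum s.
rewrite invEE0 invNN0 exc_preserved; lia.
Qed.

End Path.

End Matching.

(** * From RSK to the matching, and conclusion *)

Lemma mem_take_word n (s : 'S_n) (i : 'I_n) j : j <= n ->
  ((s i : nat) \in take j (word s)) = (i < j).
Proof.
move=> jn; apply/idP/idP => [/(nthP 0)[k]|ij].
  rewrite size_takel ?size_word // => kj; rewrite nth_take //.
  rewrite (nth_word s (Ordinal (leq_trans kj jn))) => /val_inj /perm_inj <-.
  exact: kj.
apply/(nthP 0); exists i; first by rewrite size_takel ?size_word.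
by rewrite nth_take // nth_word.
Qed.

Lemma Av321P n (s : 'S_n) : s \in Av n [:: 3; 2; 1] ->
  forall i j k : 'I_n, i < j -> j < k -> s k < s j -> s j < s i -> False.
Proof.
move=> /free321_word fs i j k ij jk h1 h2; apply: (fs i j k ij jk).
- by rewrite size_word.
- by rewrite !nth_word.
- by rewrite !nth_word.
Qed.

(** The second row of P lists values and that of Q positions: [e k] is the position of the value
    [nth 0 P1 k], and [z k] is [nth 0 Q1 k] itself. *)
Lemma Psi_matching n (s : 'S_n) : s \in Av n [:: 3; 2; 1] ->
  exists m (e z : 'I_m -> 'I_n), [/\ matching s e z,
    forall i, nth false (Psi s) (s i) = (i \notin codom e)
  & forall j : 'I_n, nth false (Psi s) (n.*2.-1 - j) = (j \in codom z)].
Proof.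
move=> /free321_word fs.
have uw : uniq (word s) by rewrite (perm_uniq (perm_word s)) iota_uniq.
have := RSK_bump_matching uw fs; have := rsk_invP uw fs.
rewrite /Psi; case: (RSK _) => P Q /= [_ _ pm _ _ pQ _ sQ _].
set P0 := row P 0; set P1 := row P 1; set Q1 := row Q 1.
case; rewrite size_word => m1 m2 m3.
rewrite size_word in pQ.
have uP : uniq (P0 ++ P1) by rewrite (perm_uniq pm).
have uP1 : uniq P1 by move: uP; rewrite cat_uniq => /and3P[].
have uQ1 : uniq Q1.
  have : uniq (row Q 0 ++ Q1) by rewrite (perm_uniq pQ) iota_uniq.
  by rewrite cat_uniq => /and3P[].
have P01 i : ((s i : nat) \in P0) = ((s i : nat) \notin P1).
  have : (s i : nat) \in P0 ++ P1.
    by rewrite (perm_mem pm) (perm_mem (perm_word s)) mem_iota add0n ltn_ord.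
  move: uP; rewrite mem_cat cat_uniq => /and3P[_ /hasPn h _].
  by case: (boolP ((s i : nat) \in P1)) => [/h /negbTE //|_]; rewrite orbF.
have /fin_all_exists[e He] : forall k : 'I_(size P1), exists i, s i = nth 0 P1 k :> nat.
  move=> k; have [_ _ /mem_take] := m1 _ (ltn_ord k).
  by case/mapP => i _ ->; exists i.
have /fin_all_exists[z Hz] :
    forall k : 'I_(size P1), exists j : 'I_n, j = nth 0 Q1 k :> nat.
  move=> k; have [h _ _] := m1 _ (ltn_ord k).
  by exists (Ordinal h).
have eP i : (i \in codom e) = ((s i : nat) \in P1).
  apply/codomP/(nthP 0) => [[k ->]|[k kP Ek]]; first by exists k; rewrite ?He.
  by exists (Ordinal kP); apply: (@val_s_inj _ s); rewrite He.
have zQ (j : 'I_n) : (j \in codom z) = ((j : nat) \in Q1).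
  apply/codomP/(nthP 0) => [[k ->]|[k kQ Ek]]; first by exists k; rewrite ?sQ ?Hz.
  by rewrite sQ in kQ; exists (Ordinal kQ); apply: val_inj; rewrite /= Hz.
have wz (k : 'I_(size P1)) : nth 0 (word s) (nth 0 Q1 k) = s (z k) by rewrite -Hz nth_word.
exists (size P1), e, z; split.
- split.
  + move=> k l E; have := congr1 (fun i => s i : nat) E; rewrite !He => /eqP.
    by rewrite nth_uniq // => /eqP/val_inj.
  + move=> k l E; have := congr1 (@nat_of_ord n) E; rewrite !Hz => /eqP.
    by rewrite nth_uniq ?sQ // => /eqP/val_inj.
  + move=> k; have [h _] := m1 _ (ltn_ord k).
    by rewrite -He -Hz mem_take_word // ltnW.
  + by move=> k; have [_ h _] := m1 _ (ltn_ord k); rewrite wz -He in h.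
  + move=> k i; rewrite eP -P01 => iP iz ie.
    rewrite -wz; apply: m2 => //; last by rewrite -He.
    by rewrite -Hz mem_take_word // ltnW.
  + move=> i j; rewrite zQ => jQ ij h.
    have [||k [kP Ek zk]] := m3 i j _ jQ; rewrite ?nth_word ?ij //=.
    exists (Ordinal kP); last by rewrite Hz.
    by apply: (@val_s_inj _ s); rewrite He Ek nth_word.
- move=> i; rewrite nth_cat size_map size_iota ltn_ord.
  by rewrite (nth_map 0) ?size_iota // nth_iota // P01 eP.
- move=> j; rewrite nth_cat size_map size_iota ltnNge.
  have jn := ltn_ord j.
  rewrite (_ : n <= n.*2.-1 - j) /=; last by lia.
  rewrite (nth_map 0) ?size_rev ?size_iota; last by lia.
  rewrite nth_rev ?size_iota; last by lia.
  rewrite nth_iota ?zQ; last by lia.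
  by rewrite [X in X \in _ = _](_ : _ = j :> nat) //; lia.
Qed.

Theorem theorem3p3 (n : nat) (hn : 0 < n) (s : 'S_n)
    (hs : s \in Av n [:: 3; 2; 1]) :
  (fp (Theta s), exc (Theta s), crs (Theta s)) = (fp s, exc s, crs s).
Proof.
have [m [e [z [M D1 D2]]]] := Psi_matching hs.
have DP := Psi_Dyck hs; have s321 := Av321P hs.
rewrite /Theta (fp_preserved s321 M DP D1 D2) (exc_preserved s321 M DP D1 D2).
by rewrite (crs_preserved s321 M DP D1 D2).
Qed.
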